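(* Let $(d_N)_N$ be a sequence of integers with $1\le d_N\le N-1$ and $Nd_N$ even. Assume that $d_N\to\infty$, $N-d_N\to\infty$ and $\left|\frac N2-d_N-\eta\sqrt{d_N}\right|\to\infty$ as $N\to\infty$, for some constant $\eta>0$. Then, for the uniform $d_N$-regular graph $G_{N,d_N}$ on $[N]$ and for any fixed finite simple graph $T$ with $n$ edges, as $N\to\infty$, $$\mathfrak C_N(T)=\left(\frac{d_N}{N}\right)^n\times O\big(d_N^{-\frac n2}\big).$$
   Context: $[N]=\{1,\ldots,N\}$. The graph $G_N=G_{N,d_N}$ is chosen uniformly at random among all simple undirected $d_N$-regular graphs on $[N]$. For a simple graph $T$ with edges $e_1,\ldots,e_n$ whose vertices are named by fixed positive integers (and $N$ at least as large as all of them), $G_N(e)$ denotes the indicator of the event that $e$ is an edge of $G_N$, $\alpha_N=\mathbb E[G_N(e)]=\frac{d_N}{N-1}$ is the probability that a given pair is an edge, and $$\mathfrak C_N(T)=\mathbb E\left[\prod_{i=1}^n\big(G_N(e_i)-\alpha_N\big)\right].$$ *)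

(* Defs.v *)
From HB Require Import structures.
From mathcomp Require Import all_boot all_order all_algebra all_fingroup.

Set Implicit Arguments.
Unset Strict Implicit.
Unset Printing Implicit Defensive.

Import Order.TTheory GRing.Theory Num.Theory.

Local Open Scope ring_scope.

(* A graph on [N] is given by its edge set, each edge being the set of its two
   endpoints; the ordinal i : 'I_N stands for the vertex i + 1. *)
Definition graph (N : nat) := {set {set 'I_N}}.

Definition simple_graph (N : nat) (G : graph N) : bool :=
  [forall e in G, #|e| == 2%N].

Definition degree (N : nat) (G : graph N) (v : 'I_N) : nat :=
  #|[set e in G | v \in e]|.

Definition regular_graphs (N d : nat) : {set graph N} :=
  [set G : graph N | simple_graph G && [forall v, degree G v == d]].

(* The value is 0 when regular_graphs N d is empty. *)
Definition expectation (R : numFieldType) (N d : nat) (f : graph N -> R) : R :=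
  (\sum_(G in regular_graphs N d) f G) / #|regular_graphs N d|%:R.

Definition edge_indicator (R : numFieldType) (N : nat) (e : {set 'I_N})
    (G : graph N) : R := (e \in G)%:R.

(* This does not depend on e: see alphaE. *)
Definition alpha (R : numFieldType) (N d : nat) (e : {set 'I_N}) : R :=
  expectation d (edge_indicator R e).

(* The pair e of vertices of [K], seen as a pair of vertices of [N]; only
   meaningful when K <= N. *)
Definition relabel (K N : nat) (e : {set 'I_K}) : {set 'I_N} :=
  [set i : 'I_N | [exists j in e, val j == val i]].

Definition centered_moment (R : numFieldType) (K : nat) (T : graph K)
    (N d : nat) : R :=
  expectation d (fun G : graph N =>
    \prod_(e in T) (edge_indicator R (relabel N e) G - alpha R d (relabel N e))).

Lemma relabelE (K N : nat) (leKN : (K <= N)%N) (e : {set 'I_K}) :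
  relabel N e = [set widen_ord leKN j | j in e].
Proof.
apply/setP=> i; rewrite inE; apply/exists_inP/imsetP.
- by case=> j je /eqP ji; exists j => //; apply: val_inj.
- by case=> j je ->; exists j.
Qed.

Section AlphaE.
Variables (N d : nat).
Implicit Types (s : {perm 'I_N}) (e : {set 'I_N}) (G : graph N).

Let actG s G : graph N := (fun e : {set 'I_N} => s @: e) @: G.

Let act_inj s : injective (fun e : {set 'I_N} => s @: e).
Proof. exact/imset_inj/perm_inj. Qed.

Let mem_actG s G e : (s @: e \in actG s G) = (e \in G).
Proof. by rewrite mem_imset //; apply: act_inj. Qed.

Let actG_regular s G : G \in regular_graphs N d -> actG s G \in regular_graphs N d.
Proof.
rewrite !inE => /andP[/forall_inP sG /forallP rG]; apply/andP; split.
  apply/forall_inP=> _ /imsetP[e eG ->].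
  by rewrite card_imset ?sG //; apply: perm_inj.
apply/forallP=> v; rewrite -(eqP (rG (s^-1 v)%g)) /degree.
rewrite -[X in _ == X](card_imset _ (@act_inj s)); apply/eqP; congr #|pred_of_set _|.
apply/setP=> f; rewrite inE; apply/andP/imsetP.
- case=> /imsetP[e eG ->] ve; exists e => //; rewrite inE eG /=.
  by case/imsetP: ve => w we ->; rewrite permK.
- case=> e; rewrite inE => /andP[eG ve] ->; rewrite mem_actG; split=> //.
  by apply/imsetP; exists (s^-1 v)%g; rewrite ?permKV.
Qed.

Let nb e : nat := #|[set G in regular_graphs N d | e \in G]|.

Let nb_act s e : (nb e <= nb (s @: e))%N.
Proof.
have inj : injective (actG s) by move=> G H; apply: imset_inj (@act_inj s) _ _.
rewrite /nb -(card_imset _ inj); apply/subset_leq_card/subsetP=> _ /imsetP[G + ->].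
by rewrite inE => /andP[rG eG]; rewrite inE actG_regular // mem_actG.
Qed.

Let nb_const (v w w' : 'I_N) : w != v -> w' != v -> nb [set v; w] = nb [set v; w'].
Proof.
move=> wv w'v; wlog suff h : w w' wv w'v / (nb [set v; w] <= nb [set v; w'])%N.
  by apply/eqP; rewrite eqn_leq !h.
apply: leq_trans (nb_act (tperm w w') _) _.
by rewrite imsetU !imset_set1 tpermL tpermD.
Qed.

Lemma alphaE (R : numFieldType) (e : {set 'I_N}) :
  regular_graphs N d != set0 -> #|e| = 2%N -> alpha R d e = d%:R / (N.-1)%:R.
Proof.
move=> ne /eqP/cards2P[v [w [vw ->]]].
set A := regular_graphs N d in ne *.
have A0 : (#|A|%:R : R) != 0 by rewrite pnatr_eq0 cards_eq0.
have N1 : (0 < N.-1)%N.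
  by rewrite -[X in X.-1]card_ord (cardD1 v) (cardD1 w) !inE eq_sym vw.
have key : (nb [set v; w] * N.-1 = d * #|A|)%N.
  have -> : (d * #|A| = \sum_(G in A) \sum_(u | u != v) ([set v; u] \in G))%N.
    rewrite mulnC -sum_nat_const; apply: eq_bigr => G.
    rewrite inE => /andP[/forall_inP sG /forallP/(_ v)/eqP <-].
    rewrite /degree -big_mkcondr /= sum1_card.
    have inj : {in [pred u | (u != v) && ([set v; u] \in G)] &,
                 injective (fun u => [set v; u])}.
      move=> x y /andP[xv _] _ /setP/(_ x).
      by rewrite !inE eqxx orbT (negPf xv) /= => /esym/eqP.
    rewrite -(card_in_imset inj); congr #|pred_of_set _|.
    apply/setP=> f; rewrite inE; apply/andP/imsetP.
    - case=> fG vf; have /cards2P[x [y [xy fE]]] := sG _ fG.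
      move: vf; rewrite fE !inE => /orP[]/eqP vE.
        by exists y; rewrite vE // inE eq_sym xy -fE.
      by exists x; [rewrite inE vE xy setUC -fE | rewrite vE setUC].
    - by case=> u /andP[_ uG] ->; rewrite uG !inE eqxx.
  rewrite exchange_big /= (eq_bigr (fun=> nb [set v; w])) => [|u uv].
    by rewrite sum_nat_const cardC1 card_ord mulnC.
  rewrite (nb_const (w' := u)) // 1?eq_sym // /nb -sum1_card -big_mkcondr /=.
  by apply: eq_bigl => G; rewrite [RHS]inE.
rewrite /alpha /expectation -/A /edge_indicator -natr_sum.
have -> : (\sum_(G in A) ([set v; w] \in G) = nb [set v; w])%N.
  by rewrite -big_mkcondr /nb -sum1_card; apply: eq_bigl => G; rewrite [RHS]inE.
apply/eqP; rewrite eqr_div // ?pnatr_eq0 -?lt0n //.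
by rewrite -!natrM key.
Qed.

End AlphaE.

(* Main.v *)
Require Import Defs.
From mathcomp Require Import all_boot all_order all_algebra.
From mathcomp Require Import ring lra zify.

(** Write p = d / (N - 1) for the edge density, q = p (1 - p), and X_uv for the
    centred indicator of the edge uv. A moment of a graph with n edges has the
    trivial size p^n; the theorem says that each edge gains a further factor
    d^(-1/2). Passing to complements changes X into - X and d into N - 1 - d, so
    that one may assume p <= 1/2.

    Two facts are used. Rows sum to zero: sum_v X_uv = 0, by regularity.
    Switchings preserve the uniform measure: if ab and xv are edges while av and
    xb are not, replace the former by the latter. Against a function of the other
    edges this yields a polynomial identity in the X (switch_moment). Fix a finite
    set W containing the vertices of a graph S and a, b, x, and sum the identity
    over the vertices v outside W. By the row sums, every sum over outside vertices
    that is linear in X becomes a sum over W, which has boundedly many terms. What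
    is left is (row_exchange)
      E[X^S (X_ab - X_xb) (q (N - |W|) - sum_(v not in W) X_av X_xv)] = small,
    where X^S is the product of the X over the edges of S. As q (N - |W|) is of
    order d, this gains a factor 1/d on E[X^S (X_ab - X_xb)], and hence, after an
    average over x, on E[X^S X_ab], provided that the inner sum can be neglected.

    The inner sum is essentially the fluctuation of the number of common neighbours
    of a and x. For very sparse graphs (p d <= 1) the trivial size is good enough.
    In general each use of the identity trades a factor of order d for one more
    distinct vertex v in the sum (defect_moment_step); after J uses there remains
    d^(-J) times a sum over J distinct vertices, and this sum is of order d^(J/2)
    because the fluctuation is of order d^(1/2) with all its moments
    (codegree_moment). Taking J large compared with n makes the remainder negligible
    as soon as p d > 1. The moments of the fluctuation are estimated by another use
    of switchings: the neighbours that a has and y has not can be exchanged with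
    those that y has and a has not, which replaces the fluctuation at a by its
    average over all vertices y; and this average vanishes by the row sums.

    Altogether (moment_step), if moments of graphs with about n edges are at most B
    times their trivial size, then those with n edges are at most C B / d times
    it, where graphs with n - 2 edges enter because X^2 = q + (1 - 2 p) X. Starting
    from the trivial size (abs_moment_bound), every round gains d^(-1) until n edges
    have gained d^(-n/2) (moment_decay_step, regular_moment_decay). *)

Set Implicit Arguments.
Unset Strict Implicit.
Unset Printing Implicit Defensive.

Import Order.TTheory GRing.Theory Num.Theory.

Local Open Scope ring_scope.

(** * Expectations and switchings *)

Section Expectation.
Variables (R : realFieldType) (N d : nat).
Implicit Types (f g : graph N -> R).

Lemma eq_expectation f g :
  (forall G, G \in regular_graphs N d -> f G = g G) ->
  expectation d f = expectation d g.
Proof. by move=> fg; rewrite /expectation (eq_bigr g). Qed.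

Lemma expectationD f g :
  expectation d (fun G => f G + g G) = expectation d f + expectation d g.
Proof. by rewrite /expectation big_split mulrDl. Qed.

Lemma expectationZ (c : R) f :
  expectation d (fun G => c * f G) = c * expectation d f.
Proof. by rewrite /expectation -mulr_sumr mulrA. Qed.

Lemma expectationN f : expectation d (fun G => - f G) = - expectation d f.
Proof. by rewrite /expectation sumrN mulNr. Qed.

Lemma expectationB f g :
  expectation d (fun G => f G - g G) = expectation d f - expectation d g.
Proof. by rewrite expectationD expectationN. Qed.

Lemma expectation_sum (I : Type) (r : seq I) (P : pred I) (F : I -> graph N -> R) :
  expectation d (fun G => \sum_(i <- r | P i) F i G)
  = \sum_(i <- r | P i) expectation d (F i).
Proof. by rewrite /expectation exchange_big /= mulr_suml. Qed.

Lemma ler_expectation f g :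
  (forall G, G \in regular_graphs N d -> f G <= g G) ->
  expectation d f <= expectation d g.
Proof.
by move=> fg; rewrite /expectation ler_wpM2r ?invr_ge0 ?ler0n ?ler_sum.
Qed.

Lemma expectation_ge0 f :
  (forall G, G \in regular_graphs N d -> 0 <= f G) -> 0 <= expectation d f.
Proof. by move=> f0; rewrite /expectation divr_ge0 ?ler0n ?sumr_ge0. Qed.

Lemma ler_norm_expectation f :
  `|expectation d f| <= expectation d (fun G => `|f G|).
Proof.
rewrite /expectation normrM [X in _ * X]ger0_norm ?invr_ge0 ?ler0n //.
by rewrite ler_wpM2r ?invr_ge0 ?ler0n ?ler_norm_sum.
Qed.

Lemma expectation_cst (c : R) : regular_graphs N d != set0 ->
  expectation d (fun _ : graph N => c) = c.
Proof.
move=> ne; rewrite /expectation sumr_const -[c *+ _]mulr_natr mulfK //.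
by rewrite pnatr_eq0 cards_eq0.
Qed.

End Expectation.

Section Switching.
Variables (N d : nat).
Implicit Types (G D : graph N) (a b u v x : 'I_N).

Lemma set2_eq a b u v :
  ([set a; b] == [set u; v]) = ((a == u) && (b == v)) || ((a == v) && (b == u)).
Proof.
apply/eqP/orP; last by case=> /andP[/eqP-> /eqP->] //; rewrite setUC.
move=> /setP E.
have := E a; have := E b; have := E u; have := E v.
rewrite !inE !eqxx /= !orbT !(eq_sym u) !(eq_sym v).
case: (a == u); case: (b == v); case: (a == v); case: (b == u) => //=;
  by [left|right|].
Qed.

Lemma regular_simple G e : G \in regular_graphs N d -> e \in G -> #|e| = 2%N.
Proof. by rewrite inE => /andP[/forall_inP h _] eG; apply/eqP/h. Qed.

Lemma degree_sum G v : degree G v = (\sum_(e : {set 'I_N}) (e \in G) * (v \in e))%N.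
Proof.
rewrite /degree -sum1_card big_mkcond; apply: eq_bigr => e _.
by rewrite inE; case: (e \in G); case: (v \in e).
Qed.

Lemma degree_simple G u : simple_graph G ->
  (\sum_v ([set u; v] \in G) = degree G u)%N.
Proof.
move=> /forall_inP sG; rewrite /degree.
have loop w : ([set u; w] \in G) -> w != u.
  by move=> /sG; apply: contraTneq => ->; rewrite setUid cards1.
have inj : {in [pred w | [set u; w] \in G] &, injective (fun w => [set u; w])}.
  move=> w y /loop wu _ /eqP.
  by rewrite set2_eq eqxx (negPf wu) /= andbF orbF => /eqP.
rewrite -big_mkcondr /= sum1_card -(card_in_imset inj).
apply/esym; congr #|pred_of_set _|.
apply/setP=> f; rewrite inE; apply/andP/imsetP.
- case=> fG vf; have /cards2P[y [z [yz fE]]] := sG _ fG.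
  move: vf; rewrite fE !inE => /orP[]/eqP vE.
    by exists z; rewrite vE // inE -fE.
  by exists y; [rewrite inE vE setUC -fE | rewrite vE setUC].
- by case=> w wG ->; rewrite !inE eqxx.
Qed.

Lemma degree_neighbours G u : G \in regular_graphs N d ->
  (\sum_v ([set u; v] \in G) = d)%N.
Proof.
by rewrite inE => /andP[sG /forallP/(_ u)/eqP <-]; apply: degree_simple.
Qed.

(** Symmetric difference, so that switching is visibly an involution. *)
Definition toggle D G : graph N := (G :\: D) :|: (D :\: G).

Lemma mem_toggle D G e : (e \in toggle D G) = (e \in D) (+) (e \in G).
Proof. by rewrite !inE; case: (e \in D); case: (e \in G). Qed.

Lemma toggleK D : involutive (toggle D).
Proof. by move=> G; apply/setP=> e; rewrite !mem_toggle addbA addbb. Qed.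

Definition switch_edges a b v x : graph N :=
  [set [set a; b]; [set x; v]; [set a; v]; [set x; b]].

Definition switch a b v x := toggle (switch_edges a b v x).

Definition switchable a b v x G :=
  [&& [set a; b] \in G, [set x; v] \in G, [set a; v] \notin G & [set x; b] \notin G].

Lemma switchC a b v x : switch a v b x =1 switch a b v x.
Proof.
move=> G; apply/setP=> e; rewrite !mem_toggle; congr (_ (+) _).
rewrite !inE -!orbA; case: (e == _) => //=; first by rewrite !orbT.
by rewrite orbCA; congr (_ || _); rewrite orbC.
Qed.

Lemma switchK a b v x : involutive (switch a b v x).
Proof. exact: toggleK. Qed.

Lemma switchable_switch a b v x G :
  switchable a b v x (switch a b v x G) = switchable a v b x G.
Proof.
have sw e : e \in switch_edges a b v x -> (e \in switch a b v x G) = (e \notin G).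
  by move=> eD; rewrite mem_toggle eD.
rewrite /switchable !sw ?inE ?eqxx ?orbT // !negbK.
by do 4?case: (_ \in G).
Qed.

Lemma in_pair a b v : a != b -> ((v \in [set a; b]) = (v == a) + (v == b) :> nat)%N.
Proof.
move=> ab; rewrite !inE; case: eqVneq => [->|//].
by rewrite (negPf ab).
Qed.

(** Every vertex has as many endpoints in the two removed edges as in the two
    added ones. *)
Lemma switch_regular a b v x G : uniq [:: a; b; v; x] ->
  switchable a b v x G -> G \in regular_graphs N d ->
  switch a b v x G \in regular_graphs N d.
Proof.
rewrite /= !inE !negb_or -!andbA => /and4P[ab av ax /and4P[bv bx vx _]].
move=> /and4P[Gab Gxv Gav Gxb] /andP[/forall_inP sG /forallP rG].
apply/andP; split.
  apply/forall_inP => e; rewrite mem_toggle.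
  have [eD _|_ /=] := boolP (e \in switch_edges _ _ _ _); last exact: sG.
  move: eD; rewrite !inE -!orbA => /or4P[]/eqP->; rewrite cards2 ?ab ?av //.
    by rewrite (eq_sym x) vx.
  by rewrite (eq_sym x) bx.
apply/forallP=> w; rewrite -(eqP (rG w)) !degree_sum.
rewrite -(eqn_add2r (\sum_(e in [set [set a; b]; [set x; v]]) (w \in e))%N).
have d1 : [set a; b] != [set x; v] by rewrite set2_eq (negPf ax) (negPf av).
have d2 : [set a; v] != [set x; b] by rewrite set2_eq (negPf ax) (negPf ab).
have E : (\sum_(e in [set [set a; b]; [set x; v]]) (w \in e) =
          \sum_(e in [set [set a; v]; [set x; b]]) (w \in e))%N.
  rewrite !big_setU1 ?in_set1 ?d1 ?d2 //= !big_set1 !in_pair ?(eq_sym x) //.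
  by rewrite [in LHS](addnC (w == x)) addnACA [in RHS](addnC (w == x)).
rewrite [X in _ == (_ + X)%N]E.
rewrite [in X in (X == _)](big_mkcond (fun e => e \in _)) -big_split /=.
rewrite (big_mkcond (fun e => e \in _)) -big_split /=.
apply/eqP; apply: eq_bigr => e _.
rewrite mem_toggle !in_setU !in_set1.
have : ((e == [set a; b]) || (e == [set x; v]) ==> (e \in G)) &&
       ((e == [set a; v]) || (e == [set x; b]) ==> (e \notin G)).
  by apply/andP; split; apply/implyP => /orP[]/eqP->.
move: (e == [set a; b]) (e == [set x; v]) (e == [set a; v]) (e == [set x; b]).
by case: (e \in G); case: (w \in e) => -[] [] [] [].
Qed.

(** The switch exchanges the regular graphs where it can be performed with those
    where it can be undone. *)
Lemma switch_expectation (R : realFieldType) a b v x (f : graph N -> R) :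
  uniq [:: a; b; v; x] ->
  expectation d (fun G => (switchable a b v x G)%:R * f G)
  = expectation d (fun G => (switchable a v b x G)%:R * f (switch a b v x G)).
Proof.
move=> U; rewrite /expectation; congr (_ / _).
rewrite (reindex_inj (inv_inj (@switchK a b v x))) /=.
rewrite [LHS]big_mkcond [RHS]big_mkcond /=; apply: eq_bigr => G _.
rewrite switchable_switch.
have [P|_] := boolP (switchable a v b x G); last by rewrite !mul0r !if_same.
suff -> : (switch a b v x G \in regular_graphs N d) = (G \in regular_graphs N d) by [].
have U' : uniq [:: a; v; b; x].
  move: U; rewrite /= !inE !negb_or -!andbA => /and4P[-> -> -> /and4P[bv -> -> _]].
  by rewrite eq_sym bv.
apply/idP/idP => H; last by rewrite -switchC switch_regular.
rewrite -(switchK a b v x G); apply: switch_regular => //.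
by rewrite switchable_switch.
Qed.

End Switching.

(** * Centred edges and the exchange of two rows *)

Section Centred.
Variables (R : realFieldType) (N d : nat).
Implicit Types (G S T : graph N) (a b u v w x : 'I_N) (e : {set 'I_N}).

Definition density : R := d%:R / N.-1%:R.

Definition centred e G : R := (e \in G)%:R - density.

(** The diagonal is set to zero so that rows can be summed over all vertices. *)
Definition entry G u v : R := if u == v then 0 else centred [set u; v] G.

Definition monomial S G : R := \prod_(e in S) centred e G.

Definition moment S : R := expectation d (monomial S).

Local Notation p := density.
Local Notation q := (density * (1 - density)).

Lemma entryC G u v : entry G u v = entry G v u.
Proof. by rewrite /entry eq_sym setUC. Qed.

Lemma entry_diag G u : entry G u u = 0.
Proof. by rewrite /entry eqxx. Qed.

Lemma entryE G u v : u != v -> entry G u v = centred [set u; v] G.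
Proof. by rewrite /entry => /negPf->. Qed.

(** An indicator is idempotent. This is how repeated edges in a product are
    removed, at the price of a moment with fewer edges. *)
Lemma centred_sqr e G : centred e G ^+ 2 = q + (1 - 2 * p) * centred e G.
Proof. by rewrite /centred; case: (e \in G) => /=; ring. Qed.

Lemma entry_sum G u : (1 < N)%N -> G \in regular_graphs N d ->
  \sum_v entry G u v = 0.
Proof.
move=> N1 GA; rewrite (bigD1 u) //= entry_diag add0r.
rewrite (eq_bigr (fun v => ([set u; v] \in G)%:R - p)); last first.
  by move=> v vu; rewrite entryE // eq_sym.
rewrite big_split /= sumr_const -natr_sum cardC1 card_ord.
have := degree_neighbours u GA; rewrite (bigD1 u) //= setUid.
have -> : ([set u] \in G) = false.
  by apply/negP => /(regular_simple GA); rewrite cards1.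
rewrite add0n => ->.
rewrite mulNrn -[p *+ _]mulr_natr divfK ?subrr //.
by rewrite pnatr_eq0; case: N N1 => [|[]].
Qed.

Section Bounds.
Hypothesis (p01 : 0 <= p <= 1).

Lemma q_ge0 : 0 <= q.
Proof. by case/andP: p01 => p0 p1; rewrite mulr_ge0 // subr_ge0. Qed.

Lemma q_le : q <= p.
Proof.
by case/andP: p01 => p0 p1; rewrite ler_piMr // lerBlDr lerDl.
Qed.

Lemma ler_norm_skew : `|1 - 2 * p| <= 1.
Proof. by case/andP: p01 => p0 p1; rewrite ler_norml; apply/andP; split; lra. Qed.

Lemma ler_norm_centred e G : `|centred e G| <= 1.
Proof.
case/andP: p01 => p0 p1; rewrite ler_norml /centred.
by case: (e \in G) => /=; apply/andP; split; lra.
Qed.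

Lemma ler_norm_entry G u v : `|entry G u v| <= 1.
Proof. by rewrite /entry; case: ifP => _; rewrite ?normr0 ?ler01 ?ler_norm_centred. Qed.

Lemma ler_norm_monomial S G : `|monomial S G| <= 1.
Proof.
rewrite /monomial normr_prod; apply: prodr_ile1 => e _.
by rewrite normr_ge0 ler_norm_centred.
Qed.

Lemma entry_sqr_sum G u : (1 < N)%N -> G \in regular_graphs N d ->
  \sum_v entry G u v ^+ 2 <= d%:R.
Proof.
move=> N1 GA; case/andP: (p01) => p0 p1.
have -> : \sum_v entry G u v ^+ 2 = \sum_(v | v != u) (q + (1 - 2 * p) * entry G u v).
  rewrite (bigD1 u) //= entry_diag expr0n add0r; apply: eq_bigr => v vu.
  by rewrite entryE 1?eq_sym // centred_sqr.
rewrite big_split /= sumr_const cardC1 card_ord -mulr_sumr.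
have := entry_sum u N1 GA; rewrite (bigD1 u) //= entry_diag add0r => ->.
rewrite mulr0 addr0 -[q *+ _]mulr_natr mulrAC {1}/density divfK; last first.
  by rewrite pnatr_eq0; case: N N1 => [|[]].
by rewrite ler_piMr ?ler0n // lerBlDr lerDl.
Qed.

End Bounds.

Lemma monomial_setU1 e S G : e \notin S ->
  monomial (e |: S) G = centred e G * monomial S G.
Proof. by move=> eS; rewrite /monomial big_setU1. Qed.

(** A repeated edge either disappears or becomes simple, by [centred_sqr]. *)
Lemma monomial_absorb e S G : e \in S ->
  monomial S G * centred e G = q * monomial (S :\ e) G + (1 - 2 * p) * monomial S G.
Proof.
move=> eS; have -> : monomial S G = centred e G * monomial (S :\ e) G.
  by rewrite -monomial_setU1 ?setD1K // !inE eqxx.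
by rewrite mulrAC -expr2 centred_sqr; ring.
Qed.

Lemma monomial_switch a b v x S G :
  (forall e, e \in switch_edges a b v x -> e \notin S) ->
  monomial S (switch a b v x G) = monomial S G.
Proof.
move=> DS; apply: eq_bigr => e eS; rewrite /centred mem_toggle.
by case: (boolP (e \in switch_edges _ _ _ _)) => // /DS; rewrite eS.
Qed.

(** B measures the loss over, or the gain on, the trivial size p^n. *)
Definition moment_bound (lo hi : nat) (B : R) :=
  forall S, simple_graph S -> (lo <= #|S| <= hi)%N -> `|moment S| <= B * p ^+ #|S|.

(** The difference of the indicators of the two states of a switching, written in
    centred edges. The terms of degree four cancel. *)
Lemma switch_moment a b v x (phi : graph N -> R) : uniq [:: a; b; v; x] ->
  (forall G, phi (switch a b v x G) = phi G) ->
  expectation d (fun G => phi G *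
    (q * (entry G a b + entry G x v - entry G a v - entry G x b)
     + (1 - 2 * p) * (entry G a b * entry G x v - entry G a v * entry G x b)
     - entry G a b * entry G x v * (entry G a v + entry G x b)
     + entry G a v * entry G x b * (entry G a b + entry G x v))) = 0.
Proof.
move=> U phiS; have := switch_expectation d phi U.
move/eqP; rewrite -subr_eq0 -expectationB => /eqP; set f := fun G => _.
move=> <-; apply: eq_expectation => G _; rewrite /f phiS.
move: U; rewrite /= !inE !negb_or -!andbA => /and4P[ab av ax /and4P[bv bx vx _]].
rewrite !entryE //; try by rewrite eq_sym.
rewrite /centred /switchable.
by case: (_ \in G); case: (_ \in G); case: (_ \in G); case: (_ \in G) => /=; ring.
Qed.

Lemma card_outside (W : {set 'I_N}) : #|[pred v | v \notin W]| = (N - #|W|)%N.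
Proof.
have WN : (#|W| <= N)%N by have := max_card W; rewrite card_ord.
by apply: (@addnI #|W|); rewrite (subnKC WN) (cardC W) card_ord.
Qed.

Section Rows.
Hypotheses (N1 : (1 < N)%N) (p01 : 0 <= p <= 1).

Definition row_in (W : {set 'I_N}) G u := \sum_(w in W) entry G u w.

Lemma row_out (W : {set 'I_N}) G u : G \in regular_graphs N d ->
  \sum_(v | v \notin W) entry G u v = - row_in W G u.
Proof.
move=> GA; apply/eqP; rewrite -addr_eq0 addrC /row_in.
by rewrite -(bigID (fun v => v \in W) predT) /= entry_sum.
Qed.

(** Sum [switch_moment] over the fresh vertices v. Since rows sum to zero, the
    linear sums over v are minus sums over W; the only sum that survives is that
    of X_av X_xv, in which v has degree two. *)
Lemma row_exchange S (W : {set 'I_N}) a b x : uniq [:: a; b; x] ->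
  a \in W -> b \in W -> x \in W -> (forall e, e \in S -> e \subset W) ->
  [set a; b] \notin S -> [set x; b] \notin S ->
  expectation d (fun G => monomial S G * (entry G a b - entry G x b) *
     (q * (N - #|W|)%:R - \sum_(v | v \notin W) entry G a v * entry G x v))
  = expectation d (fun G => monomial S G *
     (q * (row_in W G x - row_in W G a)
      + (1 - 2 * p) * (entry G a b * row_in W G x - entry G x b * row_in W G a)
      - entry G a b * entry G x b * (row_in W G x - row_in W G a))).
Proof.
move=> U aW bW xW SW abS xbS.
pose P v G := monomial S G *
    (q * (entry G a b + entry G x v - entry G a v - entry G x b)
     + (1 - 2 * p) * (entry G a b * entry G x v - entry G a v * entry G x b)
     - entry G a b * entry G x v * (entry G a v + entry G x b)
     + entry G a v * entry G x b * (entry G a b + entry G x v)).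
have : expectation d (fun G => \sum_(v | v \notin W) P v G) = 0.
  rewrite expectation_sum big1 // => v vW; apply: switch_moment.
    move: U; rewrite /= !inE !negb_or -!andbA => /and4P[-> -> -> _] /=.
    have ne w : w \in W -> w != v by apply: contraTneq => ->.
    by rewrite !ne // eq_sym ne.
  move=> G; apply: monomial_switch => e eD; apply/negP => eS.
  have /subsetP/(_ v) eW := SW _ eS.
  move: eD; rewrite !inE -!orbA => /or4P[] /eqP eE; subst e.
  - by rewrite eS in abS.
  - by move: vW; rewrite eW // !inE eqxx orbT.
  - by move: vW; rewrite eW // !inE eqxx orbT.
  - by rewrite eS in xbS.
move/eqP; set f := fun G => monomial S G * _ * _; set g := fun G => monomial S G * _.
rewrite -[expectation d f](subrK (expectation d g)) -expectationB => /eqP PE.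
rewrite -[RHS]add0r -PE; congr (_ + _); apply: eq_expectation => G GA.
rewrite /f /g /P -mulr_sumr -mulrA -mulrBr; congr (_ * _).
rewrite [in RHS](eq_bigr (fun v => q * (entry G a b - entry G x b)
   + ((q + (1 - 2 * p) * entry G a b - entry G a b * entry G x b) * entry G x v
   + ((- q - (1 - 2 * p) * entry G x b + entry G a b * entry G x b) * entry G a v
   + (entry G x b - entry G a b) * (entry G a v * entry G x v)))));
  last by move=> v _; ring.
rewrite !big_split /= -!mulr_sumr !row_out // sumr_const.
rewrite card_outside.
by rewrite -[_ *+ (N - _)]mulr_natr; ring.
Qed.

(** When the extra edge is already in S, one edge of S may disappear; the factor q
    that comes with it makes up for the missing factor p. *)
Lemma moment_extra (lo hi : nat) (B : R) S u w : 0 <= B -> moment_bound lo hi B ->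
  simple_graph S -> (lo <= #|S|.-1)%N -> (#|S| < hi)%N ->
  `|expectation d (fun G => monomial S G * entry G u w)| <= 3 * B * p ^+ #|S|.
Proof.
move=> B0 HB sS lS Sh; case/andP: (p01) => p0 p1.
have Bp k : 0 <= B * p ^+ k by rewrite mulr_ge0 ?exprn_ge0.
have [->|uw] := eqVneq u w.
  rewrite (eq_expectation (g := fun=> 0 * 0)) ?expectationZ ?mul0r ?normr0.
    by rewrite -mulrA mulr_ge0.
  by move=> G _; rewrite entry_diag !mulr0.
have [eS|eS] := boolP ([set u; w] \in S).
  have cS : (#|S| = #|S :\ [set u; w]|.+1)%N by rewrite (cardsD1 [set u; w]) eS.
  have sS' : simple_graph (S :\ [set u; w]).
    apply/forall_inP => f; rewrite !inE => /andP[_]; exact: (forall_inP sS).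
  have -> : expectation d (fun G => monomial S G * entry G u w)
     = q * moment (S :\ [set u; w]) + (1 - 2 * p) * moment S.
    rewrite /moment -!expectationZ -expectationD; apply: eq_expectation => G _.
    by rewrite entryE // monomial_absorb.
  apply: le_trans (ler_normD _ _) _.
  have split3 (z : R) : 3 * B * z = B * z + 2 * (B * z) by ring.
  rewrite split3.
  apply: lerD; rewrite normrM.
    rewrite ger0_norm ?q_ge0 //.
    apply: le_trans (ler_pM (q_ge0 p01) (normr_ge0 _) (q_le p01) (HB _ _ _)) _ => //.
      by move: lS Sh; rewrite cS => -> /ltnW/ltnW->.
    by rewrite cS exprS mulrCA.
  apply: le_trans (ler_pM (normr_ge0 _) (normr_ge0 _) (ler_norm_skew p01) (HB _ _ _)) _ => //.
    by rewrite (leq_trans lS) ?leq_pred // ltnW.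
  by rewrite ler_wpM2r // ler1n.
have -> : expectation d (fun G => monomial S G * entry G u w) = moment ([set u; w] |: S).
  by apply: eq_expectation => G _; rewrite monomial_setU1 // entryE // mulrC.
have cS : #|[set u; w] |: S| = #|S|.+1 by rewrite cardsU1 eS.
apply: le_trans (HB _ _ _) _.
- apply/forall_inP => f; rewrite !inE => /orP[/eqP->|]; first by rewrite cards2 uw.
  exact: (forall_inP sS).
- by rewrite cS Sh (leq_trans lS) // (leq_trans (leq_pred _)).
rewrite cS exprS -[3 * B * _]mulrA; apply: (@le_trans _ _ (B * p ^+ #|S|)).
  by rewrite ler_wpM2l // ler_piMl ?exprn_ge0.
by rewrite ler_peMl // ler1n.
Qed.

Lemma moment_row_in (lo hi : nat) (B : R) S (W : {set 'I_N}) u : 0 <= B -> moment_bound lo hi B ->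
  simple_graph S -> (lo <= #|S|.-1)%N -> (#|S| < hi)%N ->
  `|expectation d (fun G => monomial S G * row_in W G u)|
     <= #|W|%:R * (3 * B * p ^+ #|S|).
Proof.
move=> B0 HB sS lS Sh.
rewrite (eq_expectation (g := fun G => \sum_(w in W) monomial S G * entry G u w)).
  rewrite expectation_sum; apply: le_trans (ler_norm_sum _ _ _) _.
  rewrite mulr_natl -sumr_const; apply: ler_sum => w _.
  exact: moment_extra lS Sh.
by move=> G _; rewrite /row_in mulr_sumr.
Qed.

Lemma simple_setU1 S u w : u != w -> simple_graph S -> simple_graph ([set u; w] |: S).
Proof.
move=> uw /forall_inP sS; apply/forall_inP => f; rewrite !inE => /orP[/eqP->|/sS//].
by rewrite cards2 uw.
Qed.

Lemma row_exchange_bound (lo hi : nat) (B : R) S (W : {set 'I_N}) a b x : 0 <= B ->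
  moment_bound lo hi B -> simple_graph S -> (lo <= #|S|.-1)%N -> (#|S| + 2 < hi)%N ->
  uniq [:: a; b; x] ->
  a \in W -> b \in W -> x \in W -> (forall e, e \in S -> e \subset W) ->
  [set a; b] \notin S -> [set x; b] \notin S ->
  `|expectation d (fun G => monomial S G * (entry G a b - entry G x b) *
     (q * (N - #|W|)%:R - \sum_(v | v \notin W) entry G a v * entry G x v))|
  <= 18 * #|W|%:R * B * p ^+ #|S|.+1.
Proof.
move=> B0 HB sS lS Sh U aW bW xW SW abS xbS; rewrite row_exchange //.
have [ab xb ax] : [/\ a != b, x != b & a != x].
  by move: U; rewrite /= !inE !negb_or -!andbA (eq_sym x) => /and4P[-> -> -> _].
case/andP: (p01) => p0 p1.
have ab' : [set a; b] \notin [set x; b] |: S.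
  rewrite !inE negb_or abS andbT set2_eq (negPf ax) /=.
  by rewrite (negPf ab).
pose E S' u := expectation d (fun G => monomial S' G * row_in W G u).
pose S1 := [set a; b] |: S; pose S2 := [set x; b] |: S; pose S3 := [set a; b] |: S2.
have c1 : #|S1| = #|S|.+1 by rewrite cardsU1 abS.
have c2 : #|S2| = #|S|.+1 by rewrite cardsU1 xbS.
have c3 : #|S3| = #|S|.+2 by rewrite cardsU1 ab' c2.
have -> : expectation d (fun G => monomial S G *
     (q * (row_in W G x - row_in W G a)
      + (1 - 2 * p) * (entry G a b * row_in W G x - entry G x b * row_in W G a)
      - entry G a b * entry G x b * (row_in W G x - row_in W G a)))
   = (q * E S x - q * E S a) + ((1 - 2 * p) * E S1 x - (1 - 2 * p) * E S2 a)
     - (E S3 x - E S3 a).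
  rewrite /E -!expectationZ -!expectationB -expectationD -expectationB.
  apply: eq_expectation => G _.
  rewrite !monomial_setU1 // !entryE //; ring.
(* t bounds each of the six moments with one row sum as a factor *)
pose t := #|W|%:R * (3 * B * p ^+ #|S|.+1).
have t0 : 0 <= t by rewrite !mulr_ge0 ?exprn_ge0 ?ler0n.
have bnd S' u : simple_graph S' -> (#|S| <= #|S'| <= #|S|.+2)%N ->
    `|E S' u| <= #|W|%:R * (3 * B * p ^+ #|S'|).
  move=> sS' /andP[h1 h2]; apply: moment_row_in B0 HB sS' _ _.
    by apply: leq_trans lS _; rewrite -!subn1 leq_sub2r.
  by apply: leq_ltn_trans h2 _; rewrite -addn2.
have s1 : simple_graph S1 by apply: simple_setU1.
have s2 : simple_graph S2 by apply: simple_setU1.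
have s3 : simple_graph S3 by apply: simple_setU1.
have b0 u : `|q * E S u| <= t.
  rewrite normrM ger0_norm ?q_ge0 //.
  apply: le_trans (ler_pM (q_ge0 p01) (normr_ge0 _) (q_le p01) (bnd _ _ _ _)) _ => //.
    by rewrite leqnn ltnW.
  by rewrite /t exprS le_eqVlt mulrCA [p * (_ * _)]mulrCA eqxx.
have b1 S' u : simple_graph S' -> #|S'| = #|S|.+1 -> `|(1 - 2 * p) * E S' u| <= t.
  move=> sS' cS'; rewrite normrM -[t]mul1r; apply: ler_pM => //; first exact: ler_norm_skew.
  by rewrite /t -cS'; apply: bnd => //; rewrite cS' !leqnSn.
have b2 u : `|E S3 u| <= t.
  apply: le_trans (bnd _ _ s3 _) _; first by rewrite c3 leqnn andbT ltnW.
  by rewrite /t c3 ler_wpM2l ?ler0n // ler_wpM2l ?mulr_ge0 // exprS ler_piMl ?exprn_ge0.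
have := b0 x; have := b0 a; have := b1 _ x s1 c1; have := b1 _ a s2 c2.
have := b2 x; have := b2 a; rewrite !ler_norml.
have split18 (w z : R) : 18 * w * B * z = 6 * (w * (3 * B * z)) by ring.
rewrite split18 -/t.
clear b0 b1 b2; move: t t0 (q * E S a) (q * E S x) ((1 - 2 * p) * E S1 x)
  ((1 - 2 * p) * E S2 a) (E S3 x) (E S3 a) => t t0 t1 t2 t3 t4 t5 t6.
by move=> /andP[? ?] /andP[? ?] /andP[? ?] /andP[? ?] /andP[? ?] /andP[? ?];
  apply/andP; split; lra.
Qed.

End Rows.
End Centred.

(** * Sums over distinct vertices *)

Section DistinctSums.
Variables (R : realFieldType) (V : finType) (f : V -> R).
Implicit Types (O : {set V}).

Fixpoint distinct_sum j O : R :=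
  if j is i.+1 then \sum_(v | v \notin O) f v * distinct_sum i (v |: O) else 1.

Lemma distinct_sumS j O :
  distinct_sum j.+1 O = \sum_(v | v \notin O) f v * distinct_sum j (v |: O).
Proof. by []. Qed.

(** The excluded vertex v could have occupied any one of the j positions. *)
Lemma distinct_sum_setU1 j O v : v \notin O ->
  distinct_sum j (v |: O)
  = distinct_sum j O - j%:R * f v * distinct_sum j.-1 (v |: O).
Proof.
elim: j O v => [|j IHj] O v vO; first by rewrite /= !mul0r subr0.
have step u : u \notin v |: O ->
    f u * distinct_sum j (u |: (v |: O)) = f u * distinct_sum j (u |: O)
      - j%:R * f v * (f u * distinct_sum j.-1 (u |: (v |: O))).
  rewrite !inE negb_or => /andP[uv uO]; rewrite setUCA IHj; first by ring.
  by rewrite !inE negb_or eq_sym uv.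
have -> : distinct_sum j.+1 (v |: O)
    = \sum_(u | u \notin v |: O) f u * distinct_sum j (u |: O)
      - j%:R * f v * distinct_sum j (v |: O).
  rewrite [LHS]/= (eq_bigr _ step) sumrB -mulr_sumr.
  by case: (j) => [|//]; rewrite !mul0r.
have -> : distinct_sum j.+1 O = f v * distinct_sum j (v |: O)
    + \sum_(u | u \notin v |: O) f u * distinct_sum j (u |: O).
  rewrite [LHS]/= (bigD1 v) //=; congr (_ + _); apply: eq_bigl => u.
  by rewrite !inE negb_or andbC.
by rewrite -natr1 /=; ring.
Qed.

(** Peel off one vertex: summing freely over it costs K, and making it distinct from
    the others merges it with one of them, which costs the sum of f^2, at most K^2,
    for two vertices. Thus j distinct vertices cost j! K^j. *)
Lemma distinct_sum_bound (K : R) (M : nat) : 0 <= K ->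
  (forall O, (#|O| <= M)%N -> `|\sum_(v | v \notin O) f v| <= K) ->
  \sum_v f v ^+ 2 <= K ^+ 2 ->
  forall j O, (#|O| + j <= M.+1)%N -> `|distinct_sum j O| <= j`!%:R * K ^+ j.
Proof.
move=> K0 K1 K2 j.
elim/ltn_ind: j => -[|j] IHj O Oj; first by rewrite normr1 mul1r.
have -> : distinct_sum j.+1 O = (\sum_(v | v \notin O) f v) * distinct_sum j O
    - j%:R * \sum_(v | v \notin O) f v ^+ 2 * distinct_sum j.-1 (v |: O).
  rewrite [LHS]/= mulr_suml mulr_sumr -sumrB; apply: eq_bigr => v vO.
  by rewrite distinct_sum_setU1 //; ring.
have Kj i : 0 <= K ^+ i by rewrite exprn_ge0.
have b1 : `|(\sum_(v | v \notin O) f v) * distinct_sum j O| <= j`!%:R * K ^+ j.+1.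
  rewrite normrM exprS mulrCA; apply: ler_pM => //; first by apply: K1; lia.
  by apply: IHj => //; lia.
have b2 : `|j%:R * \sum_(v | v \notin O) f v ^+ 2 * distinct_sum j.-1 (v |: O)|
    <= j%:R * (j`!%:R * K ^+ j.+1).
  case: j {b1} IHj Oj => [|j] IHj Oj; first by rewrite !mul0r normr0.
  rewrite normrM ger0_norm ?ler0n // ler_wpM2l ?ler0n //.
  apply: le_trans (ler_norm_sum _ _ _) _.
  apply: (@le_trans _ _ (\sum_(v | v \notin O) f v ^+ 2 * (j`!%:R * K ^+ j))).
    apply: ler_sum => v vO; rewrite normrM ger0_norm ?sqr_ge0 // ler_wpM2l ?sqr_ge0 //.
    by apply: IHj => //=; rewrite cardsU1 vO /=; lia.
  rewrite -mulr_suml; apply: (@le_trans _ _ (K ^+ 2 * (j`!%:R * K ^+ j))).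
    rewrite ler_wpM2r ?mulr_ge0 ?ler0n //; apply: le_trans K2.
    rewrite [leRHS](bigID (fun v => v \notin O)) /= lerDl sumr_ge0 // => v _.
    exact: sqr_ge0.
  rewrite mulrCA -exprD add2n ler_wpM2r // ler_nat factS.
  by rewrite leq_pmull.
apply: le_trans (ler_normB _ _) _; apply: le_trans (lerD b1 b2) _.
by rewrite factS natrM -natr1 le_eqVlt; apply/orP; left; apply/eqP; ring.
Qed.

End DistinctSums.

(** * Iterating the row exchange *)

Section Chain.
Variables (R : realFieldType) (N d : nat).
Implicit Types (G S T : graph N) (a b u v w x : 'I_N) (W : {set 'I_N}).
Local Notation p := (density R N d).
Local Notation q := (density R N d * (1 - density R N d)).
Local Notation entry := (@entry R N d).
Local Notation monomial := (@monomial R N d).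
Hypotheses (N1 : (1 < N)%N) (p01 : 0 <= p <= 1).

Definition attach_path a x v S : graph N := [set a; v] |: ([set x; v] |: S).

Section FreshVertex.
Variables (a x v : 'I_N) (S : graph N) (W : {set 'I_N}).
Hypotheses (ax : a != x) (aW : a \in W) (xW : x \in W) (vW : v \notin W).
Hypothesis SW : forall e, e \in S -> e \subset W.

Let neq_fresh w : w \in W -> w != v.
Proof. by apply: contraTneq => ->. Qed.

Let fresh_notin w : [set w; v] \notin S.
Proof. by apply: contra vW => /SW/subsetP; apply; rewrite !inE eqxx orbT. Qed.

Let attach_disjoint : [set a; v] \notin [set x; v] |: S.
Proof.
rewrite !inE negb_or fresh_notin andbT.
by rewrite set2_eq eqxx (negPf ax) /= (negPf (neq_fresh aW)).
Qed.

Lemma card_attach : #|attach_path a x v S| = #|S|.+2.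
Proof. by rewrite /attach_path cardsU1 attach_disjoint cardsU1 fresh_notin !add1n. Qed.

Lemma attach_simple : simple_graph S -> simple_graph (attach_path a x v S).
Proof. by move=> sS; rewrite !simple_setU1 ?neq_fresh. Qed.

Lemma attach_subset e : e \in attach_path a x v S -> e \subset v |: W.
Proof.
have sub w : w \in W -> [set w; v] \subset v |: W.
  by move=> wW; rewrite subUset !sub1set !inE wW eqxx orbT.
rewrite !in_setU !in_set1 => /or3P[/eqP->|/eqP->|/SW eW]; rewrite ?sub //.
exact: subset_trans eW (subsetUr _ _).
Qed.

Lemma attach_notin u w : u \in W -> w \in W ->
  [set u; w] \notin S -> [set u; w] \notin attach_path a x v S.
Proof.
move=> uW wW uwS; rewrite !in_setU !in_set1 !negb_or uwS andbT !set2_eq.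
by rewrite (negPf (neq_fresh uW)) (negPf (neq_fresh wW)) !andbF.
Qed.

Lemma monomial_attach G :
  monomial (attach_path a x v S) G = entry G a v * entry G x v * monomial S G.
Proof.
rewrite !monomial_setU1 // (entryE _ _ _ (neq_fresh aW)) (entryE _ _ _ (neq_fresh xW)).
by rewrite mulrA.
Qed.

End FreshVertex.

Definition codegree_term a x G v : R := entry G a v * entry G x v.

(** For j = 0 this is E[X^S (X_ab - X_xb)]. The sum over j distinct vertices outside
    W is what the j-th power of the codegree fluctuation of a and x becomes when
    [row_exchange] is iterated. *)
Definition defect_moment a b x j S W : R :=
  expectation d (fun G => monomial S G * (entry G a b - entry G x b) *
    distinct_sum (codegree_term a x G) j W).

Lemma defect_momentS a b x j S W : a \in W -> x \in W ->
  (forall e, e \in S -> e \subset W) -> a != x ->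
  defect_moment a b x j.+1 S W = \sum_(v | v \notin W)
    defect_moment a b x j (attach_path a x v S) (v |: W).
Proof.
move=> aW xW SW ax; rewrite /defect_moment -expectation_sum.
apply: eq_expectation => G _; rewrite distinct_sumS mulr_sumr; apply: eq_bigr => v vW.
by rewrite (monomial_attach ax aW xW vW SW) /codegree_term; ring.
Qed.

(** [row_exchange] applied to S with j paths from a to x attached, summed over the
    middle vertices of these paths. *)
Lemma defect_moment_step (lo hi : nat) (B : R) a b x : 0 <= B ->
  moment_bound N d lo hi B -> uniq [:: a; b; x] ->
  forall j S W, simple_graph S -> (lo <= #|S|.-1)%N -> (#|S| + 2 * j + 2 < hi)%N ->
  (#|W| + j <= N)%N ->
  a \in W -> b \in W -> x \in W -> (forall e, e \in S -> e \subset W) ->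
  [set a; b] \notin S -> [set x; b] \notin S ->
  `|q * (N - (#|W| + j))%:R * defect_moment a b x j S W - defect_moment a b x j.+1 S W|
  <= N%:R ^+ j * (18 * (#|W| + j)%:R * B * p ^+ (#|S| + 2 * j).+1).
Proof.
move=> B0 HB U; elim=> [|j IHj] S W sS lS Sh WN aW bW xW SW abS xbS.
  rewrite !muln0 !addn0 expr0 mul1r.
  apply: le_trans (row_exchange_bound N1 p01 B0 HB sS lS _ U aW bW xW SW abS xbS).
    rewrite le_eqVlt; apply/orP; left; apply/eqP; congr `|_|.
    rewrite /defect_moment -expectationZ -expectationB.
    apply: eq_expectation => G _ /=.
    under eq_bigr do rewrite mulr1.
    rewrite /codegree_term; ring.
  by move: Sh; rewrite muln0 addn0.
have [ab xb ax] : [/\ a != b, x != b & a != x].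
  by move: U; rewrite /= !inE !negb_or -!andbA (eq_sym x) => /and4P[-> -> -> _].
have p0 : 0 <= p by case/andP: p01.
rewrite !(defect_momentS _ _ aW xW SW ax) mulr_sumr -sumrB.
apply: le_trans (ler_norm_sum _ _ _) _.
set C := _ * B * _.
apply: (@le_trans _ _ (\sum_(v : 'I_N) N%:R ^+ j * C)); last first.
  by rewrite sumr_const card_ord -[X in X <= _]mulr_natl exprS mulrA.
rewrite big_mkcond; apply: ler_sum => v _; case: ifP => [vW|_]; last first.
  by rewrite !mulr_ge0 ?exprn_ge0 ?ler0n.
set S' := attach_path a x v S.
have cS' : #|S'| = (#|S| + 2)%N by rewrite (card_attach ax aW vW SW) addn2.
have cW' : #|v |: W| = #|W|.+1 by rewrite cardsU1 vW.
have := IHj S' (v |: W); rewrite cS' cW' !addSnnS.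
rewrite -[(#|S| + 2 + 2 * j)%N]addnA -mulnS.
apply => //.
- exact: (attach_simple aW xW vW).
- by apply: leq_trans lS _; rewrite -!subn1 leq_sub2r // leq_addr.
- by rewrite !inE aW orbT.
- by rewrite !inE bW orbT.
- by rewrite !inE xW orbT.
- exact: attach_subset.
- exact: (attach_notin _ _ vW).
- exact: (attach_notin _ _ vW).
Qed.

End Chain.

(** * Gaining a factor of the degree *)

Section Step.
Variables (R : realFieldType) (N d : nat).
Implicit Types (G S T : graph N) (a b u v w x : 'I_N) (W : {set 'I_N}).
Local Notation p := (density R N d).
Local Notation q := (density R N d * (1 - density R N d)).
Local Notation entry := (@entry R N d).
Local Notation monomial := (@monomial R N d).
Local Notation defect_moment := (@defect_moment R N d).
Hypotheses (N1 : (1 < N)%N) (d0 : (0 < d)%N) (p2 : p <= 1 / 2).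

Lemma density_gt0 : 0 < p.
Proof. by rewrite divr_gt0 ?ltr0n //; case: N N1 => [|[]]. Qed.

Let p01 : 0 <= p <= 1.
Proof. by rewrite ltW ?density_gt0 //=; apply: le_trans p2 _; lra. Qed.

Lemma density_pred : p * N.-1%:R = d%:R.
Proof. by rewrite divfK // pnatr_eq0; case: N N1 => [|[]]. Qed.

Lemma ler_density_N : p * N%:R <= 2 * d%:R.
Proof.
rewrite -density_pred mulrCA ler_pM2l ?density_gt0 // -natrM ler_nat; lia.
Qed.

Lemma ler_density_sqrN : p * (p * N%:R) <= 2 * d%:R.
Proof.
have [p0 p1] := andP p01; apply: le_trans ler_density_N.
by rewrite ler_piMl // mulr_ge0.
Qed.

Lemma ler_half k : (2 * k <= N)%N -> (N.-1%:R : R) <= 2 * (N - k)%:R.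
Proof. by move=> kN; rewrite -natrM ler_nat; lia. Qed.

(** The factor of [row_exchange] is of order d as soon as W has at most half of the
    vertices. *)
Lemma variance_weight k : (2 * k <= N)%N -> d%:R / 4 <= q * (N - k)%:R.
Proof.
move=> kN; have h := ler_half kN.
apply: (@le_trans _ _ (p * (1 / 2) * (N - k)%:R)); last first.
  rewrite ler_wpM2r ?ler0n // ler_wpM2l ?(ltW density_gt0) //; have := p2; lra.
rewrite -density_pred.
have -> : p * (1 / 2) * (N - k)%:R = p * (2 * (N - k)%:R) / 4 by field.
by rewrite ler_pM2r ?invr_gt0 // ler_pM2l ?density_gt0.
Qed.

(** Solve [defect_moment_step] for its first term and substitute J times. The errors
    do not deteriorate along the way, because a new vertex brings N p^2 and a
    division by d, and N p is of order d. *)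
Lemma defect_moment_bound (lo hi : nat) (B : R) a b x S W J M : 0 <= B ->
  moment_bound N d lo hi B -> uniq [:: a; b; x] ->
  simple_graph S -> (lo <= #|S|.-1)%N -> (#|S| + 2 * J < hi)%N ->
  (#|W| + J <= M)%N -> (2 * M <= N)%N ->
  a \in W -> b \in W -> x \in W -> (forall e, e \in S -> e \subset W) ->
  [set a; b] \notin S -> [set x; b] \notin S ->
  `|defect_moment a b x 0 S W|
  <= J%:R * (72 * M%:R * 8 ^+ J * (B * p ^+ #|S|.+1 / d%:R))
     + (4 / d%:R) ^+ J * `|defect_moment a b x J S W| :> R.
Proof.
move=> B0 HB U sS lS Sh WM MN aW bW xW SW abS xbS.
have step j h1 h2 := defect_moment_step N1 p01 B0 HB U sS lS (j := j)
  h1 h2 aW bW xW SW abS xbS.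
have dp : 0 < d%:R :> R by rewrite ltr0n.
have p0 := density_gt0.
set Z := 72 * _ * _ * _.
suff: forall j, (j <= J)%N -> `|defect_moment a b x 0 S W|
   <= j%:R * Z + (4 / d%:R) ^+ j * `|defect_moment a b x j S W| by apply.
elim=> [_|j IHj jJ]; first by rewrite mul0r add0r expr0 mul1r.
apply: le_trans (IHj (ltnW jJ)) _.
have -> : j.+1%:R * Z = j%:R * Z + Z by rewrite -natr1 mulrDl mul1r.
rewrite -addrA lerD2l exprSr -mulrA.
have {step} : `|defect_moment a b x j S W| <= (4 / d%:R) *
   (`|defect_moment a b x j.+1 S W|
     + N%:R ^+ j * (18 * M%:R * B * p ^+ (#|S| + 2 * j).+1)).
  set Dj := defect_moment a b x j S W; set Dj1 := defect_moment a b x j.+1 S W.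
  have jb : (#|W| + j <= M)%N by apply: leq_trans WM; rewrite leq_add2l ltnW.
  have := step j; rewrite -/Dj -/Dj1 => {}step.
  have w4 : d%:R / 4 <= q * (N - (#|W| + j))%:R.
    by apply: variance_weight; apply: leq_trans MN; rewrite leq_mul2l.
  set c := q * _ in w4 step.
  have h1 : d%:R / 4 * `|Dj| <= `|c * Dj|.
    by rewrite (normrM c) ler_wpM2r // (le_trans w4) // ler_norm.
  have h2 : `|c * Dj| <= `|Dj1| + `|c * Dj - Dj1|.
    by rewrite addrC -[X in `|X| <= _](subrK Dj1) ler_normD.
  rewrite -invf_div ler_pdivlMl ?divr_gt0 //; apply: le_trans h1 (le_trans h2 _).
  rewrite lerD2l; apply: (le_trans (step _ _)).
  - by apply: leq_ltn_trans Sh; rewrite -addnA leq_add2l addnC -mulnS leq_mul2l.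
  - by apply: leq_trans jb _; apply: leq_trans MN; rewrite leq_pmull.
  rewrite ler_wpM2l ?exprn_ge0 ?ler0n //.
  rewrite ler_wpM2r ?exprn_ge0 ?(ltW p0) //.
  by rewrite ler_wpM2r // ler_wpM2l // ler_nat.
move=> h; apply: le_trans (ler_wpM2l (exprn_ge0 _ _) h) _.
  by rewrite divr_ge0 ?ler0n.
set Y := N%:R ^+ j * _; set D' := `|_|.
rewrite [4 / _ * (D' + Y)]mulrDr [_ ^+ j * (_ + _)]mulrDr [Z + _]addrC lerD2l.
have key : (4 / d%:R) ^+ j * (N%:R ^+ j * p ^+ (2 * j)) <= 8 ^+ J.
  apply: (@le_trans _ _ (8 ^+ j)); last by rewrite ler_weXn2l ?ler1n // ltnW.
  rewrite mulrA exprM -!exprMn lerXn2r ?nnegrE ?mulr_ge0 ?invr_ge0 ?exprn_ge0 ?ler0n ?(ltW p0) //.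
  have -> : 4 / d%:R * N%:R * p ^+ 2 = 4 * (p * (p * N%:R)) / d%:R by ring.
  rewrite ler_pdivrMr //.
  have -> : 8 * d%:R = 4 * (2 * d%:R) :> R by rewrite [RHS]mulrA -(natrM _ 4 2).
  by rewrite ler_wpM2l // ler_density_sqrN.
have -> : (4 / d%:R) ^+ j * (4 / d%:R * Y) = (72 * M%:R * (B * p ^+ #|S|.+1 / d%:R)) *
    ((4 / d%:R) ^+ j * (N%:R ^+ j * p ^+ (2 * j))).
  rewrite /Y -addSn exprD; move: (p ^+ _) (p ^+ _) (_ ^+ _) (N%:R ^+ _) => z1 z2 z3 z4.
  by field; rewrite gt_eqF.
rewrite /Z [leRHS]mulrAC ler_wpM2l //.
by rewrite !mulr_ge0 ?invr_ge0 ?exprn_ge0 ?ler0n ?(ltW p0).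
Qed.

(** Remove an edge ab of T and average E[X^S (X_ab - X_xb)] over the vertices x off T:
    the average of X_xb is a sum over the few vertices of T divided by N, so the
    average is E[X^S X_ab] up to a gain of 1/d. *)
Lemma moment_step (lo hi : nat) (B r : R) T J : 0 <= B ->
  moment_bound N d lo hi B -> simple_graph T -> (0 < #|T|)%N ->
  (lo <= #|T|.-2)%N -> (#|T| + 2 * J <= hi)%N -> (2 * (2 * #|T| + 1 + J) <= N)%N ->
  (forall a b x S W, uniq [:: a; b; x] -> simple_graph S -> #|S| = #|T|.-1 ->
    (#|W| <= 2 * #|T| + 1)%N ->
    a \in W -> b \in W -> x \in W -> (forall e, e \in S -> e \subset W) ->
    [set a; b] \notin S -> [set x; b] \notin S ->
    `|defect_moment a b x J S W| <= r) ->
  `|moment R d T| <= (J%:R * (72 * (2 * #|T| + 1 + J)%:R * 8 ^+ J) + 12 * #|T|%:R)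
                    * (B * p ^+ #|T| / d%:R) + (4 / d%:R) ^+ J * r.
Proof.
move=> B0 HB sT T0 loT hiT NT Hr.
have p0 := density_gt0.
have [e0 e0T] : exists e, e \in T by apply/set0Pn; rewrite -card_gt0.
have /cards2P[a [b [ab e0E]]] := forall_inP sT _ e0T; subst e0.
pose S := T :\ [set a; b]; pose V0 := cover T.
have cT : #|T| = #|S|.+1 by rewrite (cardsD1 [set a; b]) e0T.
have cS : #|T|.-1 = #|S| by rewrite cT.
have sS : simple_graph S.
  by apply/forall_inP => f; rewrite !inE => /andP[_]; apply: (forall_inP sT).
have TV e : e \in T -> e \subset V0 by move=> eT; apply: bigcup_sup.
have /subsetP abV := TV _ e0T.
have aV : a \in V0 by apply: abV; rewrite !inE eqxx.
have bV : b \in V0 by apply: abV; rewrite !inE eqxx orbT.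
have cV : (#|V0| <= 2 * #|T|)%N.
  apply: leq_trans (leq_card_cover T) _; rewrite mulnC -sum_nat_const.
  by apply: leq_sum => e /(forall_inP sT)/eqP->.
set t := J%:R * _.
set Q := B * p ^+ #|T| / d%:R.
have Q0 : 0 <= Q by rewrite !mulr_ge0 ?invr_ge0 ?exprn_ge0 ?ler0n ?(ltW p0).
(* Fresh vertices x: here the iterated exchange applies. *)
have diff x : x \notin V0 ->
    `|expectation d (fun G => monomial S G * (entry G a b - entry G x b))|
    <= t * Q + (4 / d%:R) ^+ J * r.
  move=> xV; have ne v : v \in V0 -> v != x by apply: contraTneq => ->.
  have U : uniq [:: a; b; x] by rewrite /= !inE negb_or ab !ne.
  have xbT : [set x; b] \notin T.
    by apply: contra xV => /TV/subsetP; apply; rewrite !inE eqxx.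
  have cW : (#|x |: V0| <= 2 * #|T| + 1)%N by rewrite cardsU1 xV addnC leq_add2r.
  have sub e : e \in S -> e \subset x |: V0.
    rewrite !inE => /andP[_ /TV eV]; exact: subset_trans eV (subsetUr _ _).
  have [h1 h2 h3] : [/\ a \in x |: V0, b \in x |: V0 & x \in x |: V0].
    by rewrite !inE aV bV eqxx !orbT.
  have h4 : [set a; b] \notin S by rewrite !inE eqxx.
  have h5 : [set x; b] \notin S by rewrite !inE negb_and xbT orbT.
  have := @defect_moment_bound lo hi B a b x S (x |: V0) J (2 * #|T| + 1 + J)
    B0 HB U sS _ _ _ NT h1 h2 h3 sub h4 h5.
  rewrite -cS => /(_ loT); rewrite cS -cT.
  have hlt : (#|S| + 2 * J < hi)%N by apply: leq_trans hiT; rewrite cT.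
  have hle : (#|x |: V0| + J <= 2 * #|T| + 1 + J)%N by rewrite leq_add2r.
  move=> /(_ hlt hle) h.
  have -> : expectation d (fun G => monomial S G * (entry G a b - entry G x b))
     = defect_moment a b x 0 S (x |: V0).
    by apply: eq_expectation => G _; rewrite /= mulr1.
  apply: le_trans h _; rewrite /t -[_ * Q]mulrA lerD2l ler_wpM2l ?exprn_ge0 ?divr_ge0 ?ler0n //.
  exact: Hr.
(* Summing over x recovers X_ab, up to a row sum inside T. *)
have tot : (N - #|V0|)%:R * moment R d T =
    \sum_(x | x \notin V0) expectation d (fun G => monomial S G * (entry G a b - entry G x b))
    - expectation d (fun G => monomial S G * row_in R d V0 G b).
  rewrite -expectation_sum -expectationB /moment -expectationZ.
  apply: eq_expectation => G GA; rewrite -mulr_sumr sumrB sumr_const.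
  have -> : \sum_(x | x \notin V0) entry G x b = - row_in R d V0 G b.
    by rewrite -row_out //; apply: eq_bigr => x _; rewrite entryC.
  rewrite card_outside.
  have -> : monomial T G = entry G a b * monomial S G.
    by rewrite entryE // -monomial_setU1 ?setD1K // !inE eqxx.
  by rewrite opprK mulrDr addrK -[_ *+ (N - _)]mulr_natr; ring.
have row : `|expectation d (fun G => monomial S G * row_in R d V0 G b)|
    <= 2 * #|T|%:R * (3 * B * p ^+ #|S|).
  apply: le_trans (moment_row_in p01 V0 b B0 HB sS _ _) _.
  - by rewrite -cS.
  - by apply: leq_trans hiT; rewrite cT leq_addr.
  by rewrite ler_wpM2r ?mulr_ge0 ?exprn_ge0 ?(ltW p0) // -natrM ler_nat.
have h2V : (2 * #|V0| <= N)%N.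
  by apply: leq_trans NT; rewrite leq_mul2l /= -addnA (leq_trans cV) ?leq_addr.
have F0 : 0 < (N - #|V0|)%:R :> R.
  have N0 : 0 < N.-1%:R :> R by rewrite ltr0n; case: (N) N1 => [|[]].
  by have := lt_le_trans N0 (ler_half h2V); rewrite pmulr_rgt0.
have key : 2 * #|T|%:R * (3 * B * p ^+ #|S|) <= (N - #|V0|)%:R * (12 * #|T|%:R * Q).
  have -> : (N - #|V0|)%:R * (12 * #|T|%:R * Q) = 6 * #|T|%:R * Q * (2 * (N - #|V0|)%:R).
    by move: (_ - _)%N%:R (#|T|%:R) Q {Q0 diff} => z1 z2 z3; ring.
  apply: (@le_trans _ _ (6 * #|T|%:R * Q * N.-1%:R)); last first.
    by apply: ler_wpM2l (ler_half h2V); apply: mulr_ge0 Q0; rewrite mulr_ge0 ?ler0n.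
  have -> : 6 * #|T|%:R * Q * N.-1%:R = 6 * #|T|%:R * (B * p ^+ #|S|) * (p * N.-1%:R / d%:R).
    rewrite /Q cT exprS; move: (_ ^+ _) (_.-1%:R) (_.+1%:R) (d%:R) => z1 z2 z3 z4; ring.
  rewrite density_pred divff ?pnatr_eq0 -?lt0n // mulr1.
  by rewrite le_eqVlt; apply/orP; left; apply/eqP; move: (_ ^+ _) (#|T|%:R) => z1 z2; ring.
rewrite -(ler_pM2l F0) -[(N - _)%:R in leLHS]ger0_norm ?ler0n // -normrM tot.
apply: le_trans (ler_normB _ _) _.
have split (z1 z2 z3 z4 z5 : R) :
  z1 * ((z2 + z3) * z4 + z5) = z1 * (z2 * z4 + z5) + z1 * (z3 * z4) by ring.
rewrite split.
apply: lerD; last exact: le_trans row key.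
apply: le_trans (ler_norm_sum _ _ _) _.
apply: le_trans (ler_sum _ (fun x xV => diff x xV)) _.
rewrite sumr_const card_outside.
by rewrite -[X in X <= _]mulr_natl.
Qed.

End Step.

(** * The trivial size of a moment *)

Section APriori.
Variables (R : realFieldType) (N d : nat).
Implicit Types (G S T : graph N) (a b u v w x : 'I_N) (V : {set 'I_N}).
Local Notation p := (density R N d).
Local Notation monomial := (@monomial R N d).
Hypotheses (N1 : (1 < N)%N) (d0 : (0 < d)%N) (p01 : 0 <= p <= 1).

Definition adjacent G u v : R := ([set u; v] \in G)%:R.

Lemma adjacentC G u v : adjacent G u v = adjacent G v u.
Proof. by rewrite /adjacent setUC. Qed.

Lemma adjacent_ge0 G u v : 0 <= adjacent G u v.
Proof. exact: ler0n. Qed.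

Lemma adjacent_le1 G u v : adjacent G u v <= 1.
Proof. by rewrite /adjacent lern1 leq_b1. Qed.

Lemma adjacent_diag G u : G \in regular_graphs N d -> adjacent G u u = 0.
Proof.
move=> GA; rewrite /adjacent setUid.
by case: (boolP (_ \in G)) => // /(regular_simple GA); rewrite cards1.
Qed.

Lemma adjacent_sum G u : G \in regular_graphs N d -> \sum_v adjacent G u v = d%:R.
Proof. by move=> GA; rewrite -natr_sum (degree_neighbours u GA). Qed.

Lemma switchableE a b v x G : (switchable a b v x G)%:R =
  adjacent G a b * adjacent G x v * (1 - adjacent G a v) * (1 - adjacent G x b).
Proof.
rewrite /switchable /adjacent.
by case: (_ \in G); case: (_ \in G); case: (_ \in G); case: (_ \in G) => /=; ring.
Qed.

(** Each vertex of V spoils at most d edges at either end. *)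
Lemma outside_edges G V : G \in regular_graphs N d ->
  (N%:R - 2 * #|V|%:R) * d%:R
  <= \sum_(v | v \notin V) \sum_(x | x \notin V) adjacent G x v.
Proof.
move=> GA.
have tot : \sum_v \sum_x adjacent G x v = N%:R * d%:R.
  under eq_bigr do under eq_bigr do rewrite adjacentC.
  by under eq_bigr do rewrite adjacent_sum //; rewrite sumr_const card_ord -[LHS]mulr_natl.
have in1 : \sum_(v in V) \sum_x adjacent G x v = #|V|%:R * d%:R.
  under eq_bigr do under eq_bigr do rewrite adjacentC.
  by under eq_bigr do rewrite adjacent_sum //; rewrite sumr_const -[LHS]mulr_natl.
have in2 : \sum_v \sum_(x in V) adjacent G x v = #|V|%:R * d%:R.
  by rewrite exchange_big; under eq_bigr do rewrite adjacent_sum //;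
    rewrite sumr_const -[LHS]mulr_natl.
have in3 : \sum_(v | v \notin V) \sum_(x in V) adjacent G x v <= #|V|%:R * d%:R.
  rewrite -in2 [leRHS](bigID (fun v => v \notin V)) /= lerDl.
  by rewrite !sumr_ge0 // => v _; rewrite sumr_ge0 // => x _; apply: adjacent_ge0.
move: tot; rewrite (bigID (fun v => v \in V)) /= in1.
rewrite [X in _ + X = _](_ : _ = \sum_(v | v \notin V) \sum_(x in V) adjacent G x v
    + \sum_(v | v \notin V) \sum_(x | x \notin V) adjacent G x v).
  by move=> tot; rewrite mulrBl -tot -mulrA mulr_natl mulr2n; lra.
rewrite -big_split; apply: eq_bigr => v _.
by rewrite (bigID (fun x => x \in V)).
Qed.

(** If ab is an edge, almost every ordered edge xv off V gives a switching: the bad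
    ones have v adjacent to a or x adjacent to b, hence number at most 2 d^2. *)
Lemma switchings_from G V a b : G \in regular_graphs N d ->
  adjacent G a b * ((N%:R - 2 * #|V|%:R - 2 * d%:R) * d%:R)
  <= \sum_(v | v \notin V) \sum_(x | (x \notin V) && (x != v)) (switchable a b v x G)%:R.
Proof.
move=> GA; pose g := adjacent G.
have g0 u v : 0 <= g u v by apply: adjacent_ge0.
have g1 u v : g u v <= 1 by apply: adjacent_le1.
have lb : \sum_(v | v \notin V) \sum_(x | x \notin V)
      (g a b * (g x v - g a v * g x v - g x b * g x v)) <=
    \sum_(v | v \notin V) \sum_(x | (x \notin V) && (x != v)) (switchable a b v x G)%:R.
  apply: ler_sum => v vV; rewrite (bigID (fun x => x != v)) /=.
  rewrite [X in _ + X]big1 ?addr0; last first.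
    by move=> x /andP[_]; rewrite negbK => /eqP->; rewrite /g adjacent_diag //; ring.
  apply: ler_sum => x _; rewrite switchableE -/(g _ _) -!mulrA ler_wpM2l //.
  have := mulr_ge0 (g0 x v) (mulr_ge0 (g0 a v) (g0 x b)).
  rewrite -!/(g _ _); move: (g x v) (g a v) (g x b) => z1 z2 z3; nra.
apply: le_trans lb; under eq_bigr do rewrite -mulr_sumr.
rewrite -mulr_sumr ler_wpM2l //.
under eq_bigr do rewrite !sumrB.
rewrite !sumrB.
have ge0s (F : 'I_N -> 'I_N -> R) : (forall u v, 0 <= F u v) ->
    \sum_(v | v \notin V) \sum_(x | x \notin V) F v x <= \sum_v \sum_x F v x.
  move=> F0; rewrite [leRHS](bigID (fun v => v \notin V)) /= -[leLHS]addr0 lerD //.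
    apply: ler_sum => v _; rewrite [leRHS](bigID (fun v => v \notin V)) /= lerDl.
    by rewrite sumr_ge0.
  by rewrite !sumr_ge0 // => v _; rewrite sumr_ge0.
have e1 : \sum_v \sum_x g a v * g x v = d%:R * d%:R.
  under eq_bigr do rewrite -mulr_sumr.
  under eq_bigr => v _ do (under eq_bigr do rewrite /g adjacentC).
  by under eq_bigr do rewrite adjacent_sum //; rewrite -mulr_suml adjacent_sum.
have e2 : \sum_v \sum_x g x b * g x v = d%:R * d%:R.
  rewrite exchange_big /=; under eq_bigr do rewrite -mulr_sumr adjacent_sum //.
  rewrite -mulr_suml; under eq_bigr do rewrite /g adjacentC.
  by rewrite adjacent_sum.
have h1 := ge0s (fun v x => g a v * g x v) (fun u v => mulr_ge0 (g0 _ _) (g0 _ _)).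
have h2 := ge0s (fun v x => g x b * g x v) (fun u v => mulr_ge0 (g0 _ _) (g0 _ _)).
have h3 := outside_edges V GA.
rewrite e1 in h1; rewrite e2 in h2.
have -> : (N%:R - 2 * #|V|%:R - 2 * d%:R) * d%:R
   = (N%:R - 2 * #|V|%:R) * d%:R - d%:R * d%:R - d%:R * d%:R :> R by ring.
by rewrite -!addrA; apply: lerD => //; rewrite -!opprD lerN2 lerD.
Qed.

(** A switching that creates ab needs a neighbour v of a and a neighbour x of b. *)
Lemma switchings_to G V a b : G \in regular_graphs N d ->
  \sum_(v | v \notin V) \sum_(x | (x \notin V) && (x != v)) (switchable a v b x G)%:R
  <= d%:R * d%:R :> R.
Proof.
move=> GA; pose g := adjacent G.
have g0 u v : 0 <= g u v by apply: adjacent_ge0.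
have g1 u v : g u v <= 1 by apply: adjacent_le1.
have -> : d%:R * d%:R = \sum_v g a v * \sum_x g x b.
  rewrite -mulr_suml adjacent_sum //; congr (_ * _).
  by under eq_bigr do rewrite /g adjacentC; rewrite adjacent_sum.
rewrite big_mkcond; apply: ler_sum => v _; case: ifP => _; last first.
  by rewrite mulr_ge0 // sumr_ge0.
rewrite mulr_sumr big_mkcond; apply: ler_sum => x _; case: ifP => _; last first.
  by rewrite mulr_ge0.
rewrite switchableE -!/(g _ _) -[leRHS]mulr1 -[_ * (1 - _) * _]mulrA.
apply: ler_pM => //; rewrite ?mulr_ge0 ?subr_ge0 //.
by rewrite mulr_ile1 ?subr_ge0 // lerBlDr lerDl.
Qed.

(** Double counting, weighted by |X^S|, of the switchings that destroy ab and of those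
    that create it: the former number at least d N / 2 when ab is an edge, the latter
    at most d^2. *)
Lemma ler_abs_edge S a b : a != b -> [set a; b] \notin S -> simple_graph S ->
  (8 * (2 * #|S| + 2) <= N)%N -> (8 * d <= N)%N ->
  expectation d (fun G => `|monomial S G| * adjacent G a b)
  <= 2 * p * expectation d (fun G => `|monomial S G|).
Proof.
move=> ab abS sS NS Nd.
pose V := [set a; b] :|: cover S.
have cV : (#|V| <= 2 * #|S| + 2)%N.
  apply: leq_trans (leq_card_setU _ _) _; rewrite cards2 ab addnC leq_add2r.
  apply: leq_trans (leq_card_cover S) _; rewrite mulnC -sum_nat_const.
  by apply: leq_sum => e /(forall_inP sS)/eqP->.
have aV : a \in V by rewrite !inE eqxx.
have bV : b \in V by rewrite !inE eqxx orbT.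
pose E1 := expectation d (fun G => `|monomial S G| * adjacent G a b).
pose E0 := expectation d (fun G => `|monomial S G|).
have E10 : 0 <= E1 by apply: expectation_ge0 => G _; rewrite mulr_ge0 ?adjacent_ge0.
have E00 : 0 <= E0 by apply: expectation_ge0.
have sw : \sum_(v | v \notin V) \sum_(x | (x \notin V) && (x != v))
    expectation d (fun G => (switchable a b v x G)%:R * `|monomial S G|)
  = \sum_(v | v \notin V) \sum_(x | (x \notin V) && (x != v))
    expectation d (fun G => (switchable a v b x G)%:R * `|monomial S G|).
  apply: eq_bigr => v vV; apply: eq_bigr => x /andP[xV xv].
  have ne u w : u \in V -> w \notin V -> u != w.
    by move=> uV; apply: contraNneq => <-.
  rewrite switch_expectation; last by rewrite /= !inE !negb_or ab !(ne a) // !(ne b) // (eq_sym v) xv.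
  apply: eq_expectation => G _; rewrite monomial_switch // => e eD.
  have outV y w : w \notin V -> [set y; w] \notin S.
    move=> wV; apply: contra wV => yw; rewrite inE; apply/orP; right.
    by apply/bigcupP; exists [set y; w] => //; rewrite !inE eqxx orbT.
  move: eD; rewrite !inE -!orbA => /or4P[] /eqP-> //; [exact: outV|exact: outV|].
  by rewrite setUC outV.
have lb : E1 * ((N%:R - 2 * #|V|%:R - 2 * d%:R) * d%:R) <= d%:R * d%:R * E0.
  apply: (@le_trans _ _ (\sum_(v | v \notin V) \sum_(x | (x \notin V) && (x != v))
    expectation d (fun G => (switchable a b v x G)%:R * `|monomial S G|))).
    under eq_bigr do rewrite -expectation_sum.
    rewrite -expectation_sum mulrC -expectationZ; apply: ler_expectation => G GA.
    under eq_bigr do rewrite -mulr_suml.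
    rewrite -mulr_suml mulrCA mulrC ler_wpM2r // mulrC.
    exact: switchings_from.
  rewrite sw.
  under eq_bigr do rewrite -expectation_sum.
  rewrite -expectation_sum -expectationZ; apply: ler_expectation => G GA.
  under eq_bigr do rewrite -mulr_suml.
  by rewrite -mulr_suml ler_wpM2r // switchings_to.
have dp : 0 < d%:R :> R by rewrite ltr0n.
have Np : 0 < N%:R :> R by rewrite ltr0n ltnW.
have hN : N%:R / 2 <= N%:R - 2 * #|V|%:R - 2 * d%:R :> R.
  have : 8 * #|V|%:R <= N%:R :> R.
    by rewrite -natrM ler_nat; apply: leq_trans NS; rewrite leq_mul2l.
  have : 8 * d%:R <= N%:R :> R by rewrite -natrM ler_nat.
  by move: (#|V|%:R) (d%:R) (N%:R) Np => z1 z2 z3; lra.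
have h : E1 * (N%:R / 2 * d%:R) <= d%:R * d%:R * E0.
  apply: le_trans lb; rewrite ler_wpM2l // ler_wpM2r // ltW //.
rewrite -/E1 -/E0.
have {}h : E1 * N%:R <= 2 * d%:R * E0.
  rewrite -(ler_pM2r dp).
  have scale (z1 z2 z3 z4 : R) :
    z1 * (z3 / 2 * z4) <= z4 * z4 * z2 -> z1 * z3 * z4 <= 2 * z4 * z2 * z4.
    by clear; lra.
  exact: scale.
apply: (@le_trans _ _ (2 * d%:R * E0 / N%:R)); first by rewrite ler_pdivlMr.
rewrite mulrAC ler_wpM2r // -mulrA ler_wpM2l // /density ler_wpM2l ?ler0n //.
by rewrite lef_pV2 ?posrE ?ltr0n ?ler_nat ?leq_pred //; case: (N) N1 => [|[]].
Qed.

(** Add the edges one at a time with [ler_abs_edge]. If d > N / 8 the switchings may be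
    too few, but then p > 1/8 and the bound is obvious. *)
Lemma abs_moment_bound T : regular_graphs N d != set0 ->
  simple_graph T -> (16 * #|T| <= N)%N ->
  expectation d (fun G => `|monomial T G|) <= 8 ^+ #|T| * p ^+ #|T|.
Proof.
move=> ne sT NT; have [p0 p1] := andP p01.
have [Nd|Nd] := leqP (8 * d) N; last first.
  apply: (@le_trans _ _ 1).
    rewrite -[leRHS](expectation_cst 1 ne); apply: ler_expectation => G _.
    exact: ler_norm_monomial.
  rewrite -exprMn; apply: exprn_ege1.
  have N0 : 0 < N.-1%:R :> R by rewrite ltr0n; case: (N) N1 => [|[]].
  rewrite /density mulrA ler_pdivlMr // mul1r -natrM ler_nat.
  by rewrite (leq_trans (leq_pred _)) // ltnW.
rewrite -exprMn; have [n cT] : {n | #|T| = n} by exists #|T|.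
elim: n T cT sT NT => [|n IHn] T cT sT NT.
  rewrite cT expr0 -[leRHS](expectation_cst 1 ne); apply: ler_expectation => G _.
  exact: ler_norm_monomial.
have [e0 e0T] : exists e, e \in T by apply/set0Pn; rewrite -card_gt0 cT.
have /cards2P[a [b [ab e0E]]] := forall_inP sT _ e0T; subst e0.
pose S := T :\ [set a; b].
have cS : #|S| = n by apply: succn_inj; rewrite -cT (cardsD1 [set a; b] T) e0T.
have sS : simple_graph S.
  by apply/forall_inP => f; rewrite !inE => /andP[_]; apply: (forall_inP sT).
have abS : [set a; b] \notin S by rewrite !inE eqxx.
have N16 : (16 * n.+1 <= N)%N by rewrite -cT.
have h := ler_abs_edge ab abS sS _ Nd.
have {}h : expectation d (fun G => `|monomial S G| * adjacent G a b)
  <= 2 * p * expectation d (fun G => `|monomial S G|).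
  by apply: h; rewrite cS; clear -N16; lia.
have ih := IHn S cS sS _.
have {}ih : expectation d (fun G => `|monomial S G|) <= (8 * p) ^+ n.
  by rewrite -cS; apply: ih; rewrite cS; clear -N16; lia.
set E0 := expectation d (fun G => `|monomial S G|) in h ih.
have E00 : 0 <= E0 by apply: expectation_ge0.
apply: (@le_trans _ _ (expectation d (fun G => `|monomial S G| * adjacent G a b)
   + p * E0)).
  rewrite -expectationZ -expectationD; apply: ler_expectation => G _.
  have -> : monomial T G = centred R d [set a; b] G * monomial S G.
    by rewrite -monomial_setU1 ?setD1K // !inE eqxx.
  rewrite normrM mulrC [p * _]mulrC -mulrDr ler_wpM2l //.
  by apply: le_trans (ler_normB _ _) _; rewrite !ger0_norm ?ler0n.
rewrite cT exprS; apply: (@le_trans _ _ (8 * p * E0)); last first.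
  by rewrite ler_wpM2l // mulr_ge0.
have : 0 <= p * E0 by rewrite mulr_ge0.
move: h; rewrite -!mulrA; clear; move: (expectation _ _) (p * E0) => z1 z2; lra.
Qed.

End APriori.

(** * Concentration of codegrees *)

Section PowerInequalities.
Variable R : realFieldType.

Lemma ler_mixed_power (x y : R) i j : 0 <= x -> 0 <= y ->
  x ^+ i * y ^+ j <= x ^+ (i + j) + y ^+ (i + j).
Proof.
move=> x0 y0; have [xy|/ltW yx] := leP x y.
  apply: (@le_trans _ _ (y ^+ (i + j))); last by rewrite lerDr exprn_ge0.
  by rewrite exprD ler_wpM2r ?exprn_ge0 // lerXn2r.
apply: (@le_trans _ _ (x ^+ (i + j))); last by rewrite lerDl exprn_ge0.
by rewrite exprD ler_wpM2l ?exprn_ge0 // lerXn2r.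
Qed.

(** The factorisation of x^k - y^k, where mixed products are at most the sum of the two
    even powers. *)
Lemma odd_power_increment (x y : R) J :
  (x - y) * (x ^+ J.*2.+1 - y ^+ J.*2.+1)
  <= J.*2.+1%:R * ((x - y) ^+ 2 * (x ^+ J.*2 + y ^+ J.*2)).
Proof.
rewrite subrXX [leLHS]mulrA -expr2 [leRHS]mulrCA ler_wpM2l ?sqr_ge0 //.
rewrite mulr_natl -[X in _ *+ X]card_ord -sumr_const; apply: ler_sum => i _.
have even_norm z : z ^+ J.*2 = `|z| ^+ J.*2 :> R.
  by rewrite -normrX ger0_norm // -mul2n exprM exprn_ge0 ?sqr_ge0.
rewrite (even_norm x) (even_norm y).
apply: le_trans (ler_norm _) _; rewrite normrM !normrX.
have iJ : (i <= J.*2.+1.-1)%N by rewrite -ltnS.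
by have := ler_mixed_power (J.*2.+1.-1 - i) i (normr_ge0 x) (normr_ge0 y); rewrite subnK.
Qed.

End PowerInequalities.

Section Concentration.
Variables (R : realFieldType) (N d : nat).
Implicit Types (G : graph N) (a u v t x y : 'I_N).
Local Notation p := (density R N d).
Local Notation entry := (@entry R N d).
Local Notation adj := (@adjacent R N).
Hypotheses (N1 : (1 < N)%N) (d0 : (0 < d)%N) (p01 : 0 <= p <= 1).

Lemma sum_delta (P : pred 'I_N) (F : 'I_N -> R) u : P u ->
  \sum_(v | P v) (v == u)%:R * F v = F u.
Proof.
move=> Pu; rewrite (bigD1 u) //= eqxx mul1r big1 ?addr0 // => v /andP[_ /negPf->].
by rewrite mul0r.
Qed.

Lemma entry_adjacent G u v : u != v -> entry G u v = adj G u v - p.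
Proof. by move=> uv; rewrite entryE. Qed.

Definition exclusive_neighbour G a y v : R := adj G a v * (1 - adj G y v).

Lemma exclusive_neighbour_bounds G a y v : 0 <= exclusive_neighbour G a y v <= 1.
Proof.
rewrite mulr_ge0 ?subr_ge0 ?adjacent_ge0 ?adjacent_le1 //=.
by rewrite mulr_ile1 ?subr_ge0 ?adjacent_ge0 ?adjacent_le1 // lerBlDr lerDl adjacent_ge0.
Qed.

Lemma switchable_exclusive a u t y G :
  (switchable a u t y G)%:R = exclusive_neighbour G a y u * exclusive_neighbour G y a t.
Proof. by rewrite switchableE /exclusive_neighbour; ring. Qed.

Section Switched.
Variables (a u t y : 'I_N).
Hypothesis U : uniq [:: a; u; t; y].

Lemma adjacent_switch_fst G v : switchable a u t y G ->
  adj (switch a u t y G) a v = adj G a v - (v == u)%:R + (v == t)%:R.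
Proof.
move: U; rewrite /= !inE !negb_or -!andbA => /and4P[au at_ ay /and4P[ut uy ty _]].
move=> /and4P[Gau Gyt Gat Gyu]; rewrite /adj mem_toggle !inE !set2_eq eqxx.
rewrite (negPf ay) (negPf au) (negPf at_) /= ?andbF ?orbF.
have [->|vu] := eqVneq v u.
  by rewrite (negPf ut) /= Gau /=; ring.
have [->|vt] /= := eqVneq v t; first by rewrite (negPf Gat) /=; ring.
by rewrite subr0 addr0.
Qed.

Lemma adjacent_switch_snd G v : switchable a u t y G ->
  adj (switch a u t y G) y v = adj G y v + (v == u)%:R - (v == t)%:R.
Proof.
move: U; rewrite /= !inE !negb_or -!andbA => /and4P[au at_ ay /and4P[ut uy ty _]].
move=> /and4P[Gau Gyt Gat Gyu]; rewrite /adj mem_toggle !inE !set2_eq eqxx.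
rewrite ![y == _]eq_sym (negPf ay) (negPf uy) (negPf ty) /= ?andbF ?orbF.
have [->|vu] := eqVneq v u.
  by rewrite (negPf ut) /= (negPf Gyu) /=; ring.
have [->|vt] /= := eqVneq v t; first by rewrite Gyt /=; ring.
by rewrite subr0 addr0.
Qed.

Lemma entry_switch_away G x v : x \notin [:: a; u; t; y] ->
  entry (switch a u t y G) x v = entry G x v.
Proof.
rewrite !inE !negb_or => /and4P[xa xu xt xy].
have [->|xv] := eqVneq x v; first by rewrite !entry_diag.
rewrite !entryE // /centred mem_toggle.
rewrite !inE !set2_eq (negPf xa) (negPf xu) (negPf xt) (negPf xy).
by rewrite /= ?andbF.
Qed.

End Switched.

(** Up to a constant and a multiple of X_ax, the deviation of the number of common
    neighbours of a and x. *)
Definition codegree_dev a x G : R := \sum_v codegree_term R d a x G v.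

Definition away a x y : pred 'I_N := fun v => v \notin [:: a; x; y].

(** A switch at a and y does not change this number, so that one may divide by it. *)
Definition exclusive_count a x y G : R := \sum_(t | away a x y t) exclusive_neighbour G y a t.

Section Exchange.
Variables (a x y : 'I_N).
Hypotheses (axy : uniq [:: a; x; y]).

Lemma away_uniq u t : away a x y u -> away a x y t -> u != t ->
  uniq [:: a; u; t; y] /\ x \notin [:: a; u; t; y].
Proof.
move: axy; rewrite /away /= !inE !negb_or -!andbA => /and4P[ax ay xy _].
move=> /and3P[ua ux uy] /and3P[ta tx ty] ut.
by rewrite (eq_sym a u) (eq_sym a t) (eq_sym x a) (eq_sym x u) (eq_sym x t) ua ta ay ut uy ty ax ux tx xy.
Qed.

(** The switch moves one neighbour of a from u to t; the row of x does not change. *)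
Lemma codegree_dev_switch u t G : away a x y u -> away a x y t -> u != t ->
  switchable a u t y G ->
  codegree_dev a x (switch a u t y G) = codegree_dev a x G - entry G x u + entry G x t.
Proof.
move=> Pu Pt ut sw; have [U xU] := away_uniq Pu Pt ut.
rewrite /codegree_dev /codegree_term.
rewrite (eq_bigr (fun v => entry G a v * entry G x v
   - (v == u)%:R * entry G x v + (v == t)%:R * entry G x v)).
  by rewrite big_split sumrB !sum_delta.
move=> v _; rewrite [entry _ x v]entry_switch_away //.
have [<-|av] := eqVneq a v.
  have [au at_] : a != u /\ a != t.
    by move: U; rewrite /= !inE !negb_or -!andbA => /and3P[-> -> _].
  by rewrite !entry_diag (negPf au) (negPf at_) !mul0r subr0 addr0.
by rewrite ![entry _ a v]entry_adjacent // adjacent_switch_fst //; ring.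
Qed.

Lemma exclusive_count_switch u t G : away a x y u -> away a x y t -> u != t ->
  switchable a u t y G -> exclusive_count a x y (switch a u t y G) = exclusive_count a x y G.
Proof.
move=> Pu Pt ut sw; have [U xU] := away_uniq Pu Pt ut.
rewrite /exclusive_count (eq_bigr (fun v => exclusive_neighbour G y a v
   + (v == u)%:R * 1 - (v == t)%:R * 1)).
  by rewrite sumrB big_split /= !sum_delta // addrK.
move=> v _; rewrite /exclusive_neighbour adjacent_switch_fst // adjacent_switch_snd //.
case/and4P: sw => Gau Gyt Gat Gyu.
have [->|vu] := eqVneq v u.
  by rewrite (negPf ut) /adjacent Gau (negPf Gyu) /=; ring.
have [->|vt] := eqVneq v t; first by rewrite /adjacent Gyt (negPf Gat) /=; ring.
by rewrite /=; ring.
Qed.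

(** Division by [exclusive_count] turns the sum over u and t into an average over the choice of
    t, and the switch does not disturb this normalisation. *)
Lemma exchange_expectation (phi : R -> R -> R) (psi : R -> R) u t :
  away a x y u -> away a x y t -> u != t ->
  expectation d (fun G => exclusive_neighbour G a y u * exclusive_neighbour G y a t *
    (phi (entry G x u) (entry G x t) * psi (codegree_dev a x G) / exclusive_count a x y G))
  = expectation d (fun G => exclusive_neighbour G a y t * exclusive_neighbour G y a u *
    (phi (entry G x u) (entry G x t)
     * psi (codegree_dev a x G - entry G x t + entry G x u) / exclusive_count a x y G)).
Proof.
move=> Pu Pt ut; have [U xU] := away_uniq Pu Pt ut.
have [U' xU'] : uniq [:: a; t; u; y] /\ x \notin [:: a; t; u; y].
  by apply: away_uniq; rewrite // eq_sym.
under eq_expectation do rewrite -switchable_exclusive.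
rewrite switch_expectation //; apply: eq_expectation => G _.
rewrite -switchable_exclusive; have [sw|_] := boolP (switchable a t u y G); last by rewrite !mul0r.
by rewrite -!(switchC a u) !entry_switch_away // exclusive_count_switch ?codegree_dev_switch // eq_sym.
Qed.

Lemma sum_away (F : 'I_N -> R) :
  \sum_v F v = F a + F x + F y + \sum_(v | away a x y v) F v.
Proof.
move: axy; rewrite /= !inE !negb_or -!andbA => /and4P[ax ay xy _].
rewrite (bigD1 a) //= (bigD1 x) 1?eq_sym //= (bigD1 y) //=; last by rewrite ![y == _]eq_sym ay xy.
by rewrite !addrA; congr (_ + _); apply: eq_bigl => v; rewrite /away !inE !negb_or -!andbA.
Qed.

Definition weight G u t : R := exclusive_neighbour G a y u * exclusive_neighbour G y a t.

(** Switching u and t changes the sign of the increment, so the left side is half an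
    expectation of (increment) times (difference of the powers before and after),
    to which [odd_power_increment] applies. *)
Lemma exchange_increment J :
  expectation d (fun G => \sum_(u | away a x y u) \sum_(t | away a x y t)
    weight G u t * ((entry G x u - entry G x t) * codegree_dev a x G ^+ J.*2.+1
                    / exclusive_count a x y G))
  <= J.*2.+1%:R * expectation d (fun G =>
    \sum_(u | away a x y u) \sum_(t | away a x y t)
      weight G u t * ((entry G x u - entry G x t) ^+ 2 * codegree_dev a x G ^+ J.*2
                      / exclusive_count a x y G)).
Proof.
pose T u t := expectation d (fun G => weight G u t *
  ((entry G x u - entry G x t) * codegree_dev a x G ^+ J.*2.+1 / exclusive_count a x y G)).
pose D u t := expectation d (fun G => weight G u t *
  ((entry G x u - entry G x t) ^+ 2 * codegree_dev a x G ^+ J.*2 / exclusive_count a x y G)).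
rewrite !expectation_sum.
under eq_bigr do rewrite expectation_sum.
under [X in _ <= _ * X]eq_bigr do rewrite expectation_sum.
rewrite -/(T _ _) -/(D _ _).
have L0 G : 0 <= (exclusive_count a x y G)^-1.
  by rewrite invr_ge0 sumr_ge0 // => v _; case/andP: (exclusive_neighbour_bounds G y a v).
have w0 G u t : 0 <= weight G u t.
  by apply: mulr_ge0; [case/andP: (exclusive_neighbour_bounds G a y u) | case/andP: (exclusive_neighbour_bounds G y a t)].
have pair u t : away a x y u -> away a x y t ->
    T u t + T t u <= J.*2.+1%:R * (D u t + D t u).
  move=> Pu Pt; have [->|ut] := eqVneq u t.
    rewrite (_ : T t t = 0) ?addr0; last first.
      rewrite /T (eq_expectation (g := fun G => 0 * T t t)) ?expectationZ ?mul0r // => G _.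
      by rewrite subrr !mul0r mulr0.
    rewrite mulr_ge0 ?ler0n // addr_ge0 // expectation_ge0 // => G _;
    by rewrite mulr_ge0 // mulr_ge0 // mulr_ge0 ?sqr_ge0 // -mul2n exprM exprn_ge0 ?sqr_ge0.
  have tu : t != u by rewrite eq_sym.
  have /= eT := exchange_expectation (fun c c' => c - c') (fun z => z ^+ J.*2.+1) Pt Pu tu.
  have /= eD := exchange_expectation (fun c c' => (c - c') ^+ 2) (fun z => z ^+ J.*2) Pt Pu tu.
  have -> : T t u = _ := eT; have -> : D t u = _ := eD.
  rewrite -!expectationD -expectationZ; apply: ler_expectation => G _.
  rewrite -/(weight G u t) -!mulrDr [leRHS]mulrCA; apply: ler_wpM2l => //.
  rewrite -!mulrDl mulrA ler_wpM2r //.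
  set H := codegree_dev a x G; set c := entry G x u; set c' := entry G x t.
  have := odd_power_increment H (H - c + c') J.
  have -> : H - (H - c + c') = c - c' by ring.
  move=> h; apply: le_trans (le_trans _ h) _.
    by rewrite le_eqVlt; apply/orP; left; apply/eqP; move: (_ ^+ _) (_ ^+ _) => z1 z2; ring.
  by rewrite le_eqVlt; apply/orP; left; apply/eqP; move: (H ^+ _) ((H - c + c') ^+ _) => z1 z2; ring.
(* The swap of u and t symmetrises both sides. *)
have dbl (F : 'I_N -> 'I_N -> R) : \sum_(u | away a x y u) \sum_(t | away a x y t) (F u t + F t u)
   = 2 * \sum_(u | away a x y u) \sum_(t | away a x y t) F u t.
  under eq_bigr do rewrite big_split /=.
  by rewrite big_split /= [X in _ + X]exchange_big /= mulr_natl mulr2n.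
rewrite -(ler_pM2l (ltr0n R 2)) mulrCA -!dbl mulr_sumr.
apply: ler_sum => u Pu; rewrite mulr_sumr; apply: ler_sum => t Pt; exact: pair.
Qed.

(** The vertices a and y have the same degree, so the two numbers could differ only
    through the vertex x, which is left out. *)
Lemma exclusive_imbalance G : G \in regular_graphs N d ->
  `|\sum_(v | away a x y v) exclusive_neighbour G a y v - exclusive_count a x y G| <= 1.
Proof.
move=> GA; rewrite /exclusive_count -sumrB.
rewrite (eq_bigr (fun v => adj G a v - adj G y v)); last first.
  by move=> v _; rewrite /exclusive_neighbour; ring.
rewrite sumrB; have := adjacent_sum R a GA; have := adjacent_sum R y GA.
rewrite !sum_away (adjacent_diag R a GA) (adjacent_diag R y GA) (adjacentC R G a y).
have := adjacent_ge0 R G a x; have := adjacent_le1 R G a x.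
have := adjacent_ge0 R G y x; have := adjacent_le1 R G y x.
rewrite ler_norml => h1 h2 h3 h4 h5 h6; apply/andP; split; lra.
Qed.

(** Each of the two sums over u and t contains a free sum, which cancels the division by
    [exclusive_count]; what remains is the sum of squares over the row of x. *)
Lemma exchange_energy G : G \in regular_graphs N d ->
  \sum_(u | away a x y u) \sum_(t | away a x y t)
    weight G u t * (entry G x u - entry G x t) ^+ 2 / exclusive_count a x y G <= 6 * d%:R.
Proof.
move=> GA; have imb := exclusive_imbalance GA.
set L := exclusive_count a x y G in imb *; set L1 := \sum_(v | _) _ in imb.
have dge : 0 <= d%:R :> R by rewrite ler0n.
have [L0|L0] := eqVneq L 0.
  rewrite big1 ?mulr_ge0 // => u _; rewrite big1 // => t _.
  by rewrite L0 invr0 mulr0.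
have o0 b c v : 0 <= exclusive_neighbour G b c v by case/andP: (exclusive_neighbour_bounds G b c v).
have o1 b c v : exclusive_neighbour G b c v <= 1 by case/andP: (exclusive_neighbour_bounds G b c v).
have Lge1 : 1 <= L.
  have [n Ln] : exists n : nat, L = n%:R.
    exists (\sum_(t | away a x y t) ([set y; t] \in G) * ([set a; t] \notin G))%N.
    rewrite natr_sum; apply: eq_bigr => t _; rewrite /exclusive_neighbour /adjacent natrM.
    by case: (_ \in G); case: (_ \in G) => /=; ring.
  by move: L0; rewrite Ln pnatr_eq0 ler1n lt0n.
have L1L : L1 <= 2 * L by move: imb; rewrite ler_norml => /andP[_]; lra.
have sq (b c : 'I_N) : \sum_(v | away a x y v) exclusive_neighbour G b c v * entry G x v ^+ 2 <= d%:R.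
  apply: le_trans (entry_sqr_sum p01 x N1 GA).
  rewrite big_mkcond; apply: ler_sum => v _; case: ifP => _; last exact: sqr_ge0.
  by rewrite ler_piMl ?sqr_ge0.
apply: (@le_trans _ _ ((2 * L * (\sum_(v | away a x y v) exclusive_neighbour G a y v * entry G x v ^+ 2)
   + 2 * L1 * (\sum_(v | away a x y v) exclusive_neighbour G y a v * entry G x v ^+ 2)) / L)); last first.
  rewrite ler_pdivrMr ?(lt_le_trans ltr01) //.
  have L10 : 0 <= L1 by apply: sumr_ge0.
  have h1 : L * (\sum_(v | away a x y v) exclusive_neighbour G a y v * entry G x v ^+ 2) <= L * d%:R.
    by rewrite ler_wpM2l // ltW // (lt_le_trans ltr01).
  have h2 : L1 * (\sum_(v | away a x y v) exclusive_neighbour G y a v * entry G x v ^+ 2) <= L1 * d%:R.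
    by rewrite ler_wpM2l.
  have h3 : L1 * d%:R <= 2 * L * d%:R by rewrite ler_wpM2r.
  move: h1 h2 h3; rewrite -!mulrA [d%:R * L]mulrC; clear.
  move: (L * _) (L1 * _) (L1 * _) (L * d%:R) => z1 z2 z3 z4; lra.
set A := \sum_(v | _) exclusive_neighbour G a y v * _; set B := \sum_(v | _) exclusive_neighbour G y a v * _.
have row u : \sum_(t | away a x y t) exclusive_neighbour G y a t * (2 * (entry G x u ^+ 2 + entry G x t ^+ 2))
    = 2 * (L * entry G x u ^+ 2) + 2 * B.
  rewrite /L /exclusive_count mulr_suml !mulr_sumr -big_split /=.
  by apply: eq_bigr => t _; ring.
apply: (@le_trans _ _ (\sum_(u | away a x y u)
    exclusive_neighbour G a y u * (2 * (L * entry G x u ^+ 2) + 2 * B) / L)).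
  apply: ler_sum => u _; rewrite -row mulr_sumr mulr_suml; apply: ler_sum => t _.
  rewrite ler_wpM2r ?invr_ge0 ?(le_trans ler01) // /weight -mulrA ler_wpM2l // ler_wpM2l //.
  rewrite -subr_ge0.
  have -> : 2 * (entry G x u ^+ 2 + entry G x t ^+ 2) - (entry G x u - entry G x t) ^+ 2
     = (entry G x u + entry G x t) ^+ 2 by ring.
  exact: sqr_ge0.
rewrite -mulr_suml ler_wpM2r ?invr_ge0 ?(le_trans ler01) //.
rewrite -[2 * L1 * B]mulrA [2 * (L1 * B)]mulrCA /A /L1 mulr_sumr mulr_suml -big_split /=.
by apply: ler_sum => u _; rewrite le_eqVlt; apply/orP; left; apply/eqP; ring.
Qed.

(** The difference of the rows of a and y, weighted by the row of x, is the average
    increment of a random exchange, up to the imbalance of at most one vertex. *)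
Lemma exchange_drift G : G \in regular_graphs N d ->
  `|\sum_(v | away a x y v) (adj G a v - adj G y v) * entry G x v
    - \sum_(u | away a x y u) \sum_(t | away a x y t)
        weight G u t * (entry G x u - entry G x t) / exclusive_count a x y G| <= 1.
Proof.
move=> GA; have imb := exclusive_imbalance GA.
have o0 b c v : 0 <= exclusive_neighbour G b c v by case/andP: (exclusive_neighbour_bounds G b c v).
pose P1 := \sum_(v | away a x y v) exclusive_neighbour G a y v * entry G x v.
pose Q1 := \sum_(v | away a x y v) exclusive_neighbour G y a v * entry G x v.
have PQ b c : `|\sum_(v | away a x y v) exclusive_neighbour G b c v * entry G x v|
    <= \sum_(v | away a x y v) exclusive_neighbour G b c v.
  apply: le_trans (ler_norm_sum _ _ _) _; apply: ler_sum => v _.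
  by rewrite normrM ger0_norm // ler_piMr // ler_norm_entry.
have bP := PQ a y; have bQ := PQ y a; rewrite -/P1 in bP; rewrite -/Q1 in bQ.
have -> : \sum_(v | away a x y v) (adj G a v - adj G y v) * entry G x v = P1 - Q1.
  by rewrite /P1 /Q1 -sumrB; apply: eq_bigr => v _; rewrite /exclusive_neighbour; ring.
rewrite -/(exclusive_count a x y G) in bQ.
set L := exclusive_count a x y G in imb bQ *; set L1 := \sum_(v | _) _ in imb bP.
have row u : \sum_(t | away a x y t) exclusive_neighbour G y a t * (entry G x u - entry G x t)
    = L * entry G x u - Q1.
  rewrite /L /exclusive_count mulr_suml -sumrB.
  by apply: eq_bigr => t _; ring.
have -> : \sum_(u | away a x y u) \sum_(t | away a x y t)
    weight G u t * (entry G x u - entry G x t) / L = (L * P1 - L1 * Q1) / L.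
  rewrite /P1 /L1 mulr_sumr mulr_suml -sumrB mulr_suml; apply: eq_bigr => u _.
  rewrite (mulrCA L) -mulrBr -row mulr_sumr mulr_suml; apply: eq_bigr => t _.
  by rewrite /weight -!mulrA.
have [L0|L0] := eqVneq L 0.
  move: imb bP bQ; rewrite L0 invr0 mulr0 subr0 normr_le0 => imb bP /eqP->.
  rewrite !subr0; exact: le_trans bP (le_trans (ler_norm _) imb).
have Lp : 0 < L by rewrite lt_neqAle eq_sym L0 sumr_ge0.
have -> : P1 - Q1 - (L * P1 - L1 * Q1) / L = (L1 - L) * (Q1 / L) by field.
rewrite normrM mulr_ile1 // normrM normfV (gtr0_norm Lp) ler_pdivrMr ?mul1r //.
Qed.

Lemma codegree_dev_diff G : codegree_dev a x G - codegree_dev y x G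
  = \sum_(v | away a x y v) (adj G a v - adj G y v) * entry G x v
    + entry G a y * (entry G x y - entry G x a).
Proof.
rewrite /codegree_dev /codegree_term -sumrB sum_away !entry_diag (entryC R d G y a).
rewrite !mulr0 !mul0r; rewrite (eq_bigr (fun v => (adj G a v - adj G y v) * entry G x v)).
  by rewrite addrC; congr (_ + _); ring.
move=> v; rewrite /away !inE !negb_or => /and3P[va vx vy].
by rewrite ![entry _ _ v]entry_adjacent 1?eq_sym // -mulrBl; congr (_ * _); ring.
Qed.

End Exchange.

Lemma codegree_dev_total x G : G \in regular_graphs N d ->
  \sum_y codegree_dev y x G = 0.
Proof.
move=> GA; rewrite /codegree_dev exchange_big big1 // => v _.
rewrite -mulr_suml; under eq_bigr do rewrite entryC.
by rewrite entry_sum ?mul0r.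
Qed.

(** Average over y: the fluctuation at a is the mean of its differences with those at y.
    Each difference is an exchange increment up to a bounded error, which multiplies
    one power less and is absorbed by the inequality 4 |H| <= H^2 / 2 + 8. *)
Lemma codegree_moment_step a x J : a != x ->
  expectation d (fun G => codegree_dev a x G ^+ J.*2.+2)
  <= 28 * J.*2.+1%:R * d%:R * expectation d (fun G => codegree_dev a x G ^+ J.*2).
Proof.
move=> ax; set M := expectation d (fun G => _ ^+ J.*2).
have M0 : 0 <= M.
  by apply: expectation_ge0 => G _; rewrite -mul2n exprM exprn_ge0 ?sqr_ge0.
have N0 : 0 < N.-1%:R :> R by rewrite ltr0n; case: (N) N1 => [|[]].
have dN : d%:R <= N.-1%:R :> R.
  by have [_] := andP p01; rewrite /density ler_pdivrMr ?mul1r.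
have d1 : 1 <= d%:R :> R by rewrite ler1n.
pose P y := (y != a) && (y != x).
pose g y G := \sum_(u | away a x y u) \sum_(t | away a x y t)
    weight a y G u t * ((entry G x u - entry G x t) * codegree_dev a x G ^+ J.*2.+1
                    / exclusive_count a x y G).
have cP : (\sum_(y | P y) 1 : R) = N.-2%:R.
  have E := card_ord N; rewrite (cardD1 a) (cardD1 x) !inE eq_sym ax /= in E.
  rewrite sumr_const -[X in X.-2]E; congr (_%:R).
  by apply: eq_card => y; rewrite !inE andbT andbC.
have uP y : P y -> uniq [:: a; x; y].
  by move=> /andP[ya yx]; rewrite /= !inE !negb_or ax (eq_sym a) ya (eq_sym x) yx.
have gE y : P y -> expectation d (g y) <= 6 * J.*2.+1%:R * d%:R * M.
  move=> /uP U; apply: le_trans (exchange_increment U J) _.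
  rewrite [6 * _]mulrC -!mulrA ler_wpM2l ?ler0n // mulrA -expectationZ.
  apply: ler_expectation => G GA.
  have := exchange_energy U GA; set e := \sum_(u | _) _ => eb.
  rewrite (_ : \sum_(u | _) _ = e * codegree_dev a x G ^+ J.*2).
    by rewrite ler_wpM2r // -mul2n exprM exprn_ge0 ?sqr_ge0.
  rewrite /e mulr_suml; apply: eq_bigr => u _; rewrite mulr_suml; apply: eq_bigr => t _.
  by ring.
have pt G : G \in regular_graphs N d ->
    N.-1%:R / 2 * codegree_dev a x G ^+ J.*2.+2
    <= \sum_(y | P y) g y G + 8 * N.-1%:R * codegree_dev a x G ^+ J.*2.
  move=> GA; set H := codegree_dev a x G.
  pose k y := \sum_(u | away a x y u) \sum_(t | away a x y t)
        weight a y G u t * (entry G x u - entry G x t) / exclusive_count a x y G.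
  have gk y : g y G = k y * H ^+ J.*2.+1.
    rewrite /g /k mulr_suml; apply: eq_bigr => u _; rewrite mulr_suml.
    by apply: eq_bigr => t _; rewrite -/H; ring.
  have near y : P y -> `|H - codegree_dev y x G - k y| <= 3.
    move=> /uP U; rewrite codegree_dev_diff // addrAC.
    apply: le_trans (ler_normD _ _) _.
    have -> : 3 = 1 + 2 :> R by ring.
    apply: lerD; first exact: exchange_drift.
    rewrite normrM -[2]mul1r; apply: ler_pM => //; first exact: ler_norm_entry.
    by apply: le_trans (ler_normB _ _) _; rewrite -[2]/(1 + 1); apply: lerD; apply: ler_norm_entry.
  have Hx : `|codegree_dev x x G| <= d%:R.
    rewrite /codegree_dev /codegree_term ger0_norm.
      by under eq_bigr do rewrite -expr2; apply: entry_sqr_sum.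
    by apply: sumr_ge0 => v _; rewrite -expr2 sqr_ge0.
  have tot : N.-1%:R * H = \sum_(y | P y) (H - codegree_dev y x G) - codegree_dev x x G.
    have := codegree_dev_total x GA; rewrite (bigD1 a) //= (bigD1 x) 1?eq_sym //= -/H.
    have HN : \sum_(y | P y) H = N.-2%:R * H.
      by rewrite -cP mulr_suml; apply: eq_bigr => y _; rewrite mul1r.
    rewrite sumrB HN; set s := \sum_(y | P y) _ => s0.
    have {}s0 : H + (codegree_dev x x G + s) = 0 := s0.
    have -> : N.-1%:R = N.-2%:R + 1 :> R by rewrite natr1; case: (N) N1 => [|[]].
    have -> : s = - H - codegree_dev x x G by move: s0; clear; lra.
    by ring.
  have rem : `|N.-1%:R * H - \sum_(y | P y) k y| <= 4 * N.-1%:R.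
    rewrite tot addrAC -sumrB; apply: le_trans (ler_normB _ _) _.
    have -> : 4 * N.-1%:R = 3 * N.-1%:R + N.-1%:R :> R by ring.
    apply: lerD; last exact: le_trans Hx dN.
    apply: le_trans (ler_norm_sum _ _ _) _.
    apply: (@le_trans _ _ (\sum_(y | P y) 3 * 1)).
      by apply: ler_sum => y /near; rewrite mulr1.
    by rewrite -mulr_sumr cP ler_wpM2l // ler_nat -[N.-2]/(N.-1.-1) leq_pred.
  have -> : \sum_(y | P y) g y G = (\sum_(y | P y) k y) * H ^+ J.*2.+1.
    by rewrite mulr_suml; apply: eq_bigr => y _; rewrite gk.
  rewrite -/H.
  have evn : H ^+ J.*2 = `|H| ^+ J.*2.
    by rewrite -normrX ger0_norm // -mul2n exprM exprn_ge0 ?sqr_ge0.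
  have h1 : (N.-1%:R * H - \sum_(y | P y) k y) * H ^+ J.*2.+1
      <= 4 * N.-1%:R * (`|H| * H ^+ J.*2).
    apply: le_trans (ler_norm _) _; rewrite normrM exprS normrM evn normrX normr_id.
    by rewrite ler_wpM2r ?mulr_ge0 ?exprn_ge0.
  have h2 : 4 * `|H| <= H ^+ 2 / 2 + 8.
    have := sqr_ge0 (`|H| - 4); rewrite sqrrB (real_normK (num_real H)); clear; lra.
  have h3 : 4 * N.-1%:R * (`|H| * H ^+ J.*2) <= (H ^+ 2 / 2 + 8) * (N.-1%:R * H ^+ J.*2).
    have -> : 4 * N.-1%:R * (`|H| * H ^+ J.*2) = 4 * `|H| * (N.-1%:R * H ^+ J.*2).
      by move: (_ ^+ _) => z; ring.
    by rewrite ler_wpM2r // mulr_ge0 ?ler0n // evn exprn_ge0.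
  have := le_trans h1 h3; rewrite !exprS; move: (H ^+ J.*2) (\sum_(y | _) _) => z1 z2; lra.
have h : N.-1%:R / 2 * expectation d (fun G => codegree_dev a x G ^+ J.*2.+2)
   <= N.-1%:R * (6 * J.*2.+1%:R * d%:R * M) + 8 * N.-1%:R * M.
  rewrite -expectationZ; apply: le_trans (ler_expectation pt) _.
  rewrite expectationD expectationZ lerD2r expectation_sum.
  apply: (@le_trans _ _ (\sum_(y | P y) 1 * (6 * J.*2.+1%:R * d%:R * M))).
    by apply: ler_sum => y /gE; rewrite mul1r.
  rewrite -mulr_suml cP; apply: ler_wpM2r; last by rewrite ler_nat leq_pred.
  by rewrite mulr_ge0 // !mulr_ge0 ?ler0n.
have q1 : 1 <= J.*2.+1%:R :> R by rewrite ler1n.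
have dq : M <= J.*2.+1%:R * d%:R * M.
  by rewrite -[leLHS]mul1r ler_wpM2r // mulr_ege1.
rewrite -(ler_pM2l N0).
have : N.-1%:R * M <= N.-1%:R * (J.*2.+1%:R * d%:R * M) by rewrite ler_wpM2l // ltW.
move: h; clear; move: (expectation _ _) => z; lra.
Qed.

Lemma codegree_moment a x J : regular_graphs N d != set0 -> a != x ->
  expectation d (fun G => codegree_dev a x G ^+ J.*2)
  <= (\prod_(i < J) (28 * i.*2.+1)%N)%:R * d%:R ^+ J.
Proof.
move=> ne ax; elim: J => [|J IHJ].
  by rewrite big_ord0 expr0 mulr1 (eq_expectation (g := fun=> 1)) ?expectation_cst.
rewrite doubleS; apply: le_trans (codegree_moment_step J ax) _.
rewrite big_ord_recr /= !natrM exprS.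
apply: le_trans (ler_wpM2l _ IHJ) _; first by rewrite !mulr_ge0 ?ler0n.
rewrite le_eqVlt; apply/orP; left; apply/eqP.
by move: (\prod_(_ < _) _)%N%:R (_ ^+ _) => z1 z2; ring.
Qed.

End Concentration.

(** * The two regimes of the gain *)

Section Residual.
Variables (R : realFieldType) (N d : nat) (s : R).
Implicit Types (G S T : graph N) (a b u v w x : 'I_N) (W : {set 'I_N}).
Local Notation p := (density R N d).
Local Notation entry := (@entry R N d).
Local Notation monomial := (@monomial R N d).
Local Notation defect_moment := (@defect_moment R N d).
Hypotheses (N1 : (1 < N)%N) (d0 : (0 < d)%N) (p2 : p <= 1 / 2).
Hypotheses (s0 : 0 <= s) (sd : s ^+ 2 = d%:R).

Let p0 : 0 < p := density_gt0 R N1 d0.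

Let p01 : 0 <= p <= 1.
Proof. by rewrite ltW //=; apply: le_trans p2 _; lra. Qed.

Lemma root_ge1 : 1 <= s.
Proof. by rewrite -(@ler_pXn2r _ 2) ?nnegrE // expr1n sd ler1n. Qed.

Lemma ler_power_sum (y z : R) k : 0 <= y -> 0 <= z ->
  (y + z) ^+ k <= 2 ^+ k * (y ^+ k + z ^+ k).
Proof.
move=> y0 z0; have [yz|/ltW zy] := leP y z.
  apply: (@le_trans _ _ ((2 * z) ^+ k)).
    by rewrite lerXn2r ?nnegrE ?addr_ge0 ?mulr_ge0 // mulr_natl mulr2n lerD2r.
  by rewrite exprMn ler_wpM2l ?exprn_ge0 // lerDr exprn_ge0.
apply: (@le_trans _ _ ((2 * y) ^+ k)).
  by rewrite lerXn2r ?nnegrE ?addr_ge0 ?mulr_ge0 // mulr_natl mulr2n lerD2l.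
by rewrite exprMn ler_wpM2l ?exprn_ge0 // lerDl exprn_ge0.
Qed.

(** [distinct_sum_bound] with K = |H| + (M + 1) s, where H is the fluctuation and s is the
    root of d: excluding at most M vertices from H changes it by at most M, and the
    squares sum to at most d = s^2. *)
Lemma codegree_sum_bound a x G M j W : a != x -> G \in regular_graphs N d ->
  (#|W| + j <= M.+1)%N ->
  `|distinct_sum (codegree_term R d a x G) j W|
  <= j`!%:R * (`|codegree_dev R d a x G| + M.+1%:R * s) ^+ j.
Proof.
move=> ax GA; apply: distinct_sum_bound.
- by rewrite addr_ge0 // mulr_ge0 ?ler0n.
- move=> O OM.
  have -> : \sum_(v | v \notin O) codegree_term R d a x G v
     = codegree_dev R d a x G - \sum_(v in O) codegree_term R d a x G v.
    by rewrite /codegree_dev [X in _ = X - _](bigID (fun v => v \in O)) /= addrAC subrr add0r.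
  apply: le_trans (ler_normB _ _) _; rewrite lerD2l.
  apply: (@le_trans _ _ (#|O|%:R)).
    apply: le_trans (ler_norm_sum _ _ _) _; rewrite -sumr_const; apply: ler_sum => v _.
    by rewrite normrM mulr_ile1 // ler_norm_entry.
  apply: (@le_trans _ _ (M.+1%:R)); first by rewrite ler_nat ltnW // ltnS.
  by rewrite ler_peMr ?ler0n ?root_ge1.
- apply: (@le_trans _ _ (s ^+ 2)); last first.
    rewrite lerXn2r ?nnegrE ?addr_ge0 ?mulr_ge0 ?ler0n // -[leLHS]add0r lerD //.
    by rewrite ler_peMl // ler1n.
  rewrite sd; apply: le_trans (entry_sqr_sum p01 a N1 GA).
  apply: ler_sum => v _; rewrite /codegree_term exprMn ler_piMr ?sqr_ge0 //.
  by rewrite -real_normK ?num_real // exprn_ile1 // ler_norm_entry.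
Qed.

Definition codegree_constant (M J : nat) : R :=
  2 * (J.*2`!%:R * (2 ^+ J.*2 *
    ((\prod_(i < J) (28 * i.*2.+1)%N)%:R + M.+1%:R ^+ J.*2))).

Lemma codegree_constant_ge0 M J : 0 <= codegree_constant M J.
Proof. by rewrite !mulr_ge0 ?addr_ge0 ?exprn_ge0 ?ler0n. Qed.

Lemma defect_moment_dense a b x S W M J : regular_graphs N d != set0 -> a != x ->
  (#|W| + J.*2 <= M.+1)%N ->
  `|defect_moment a b x J.*2 S W| <= codegree_constant M J * d%:R ^+ J.
Proof.
move=> ne ax WM; apply: le_trans (ler_norm_expectation _ _) _.
pose c : R := 2 * (J.*2`!%:R * 2 ^+ J.*2).
have c0 : 0 <= c by rewrite !mulr_ge0 ?exprn_ge0 ?ler0n.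
apply: (@le_trans _ _ (expectation d (fun G => c * codegree_dev R d a x G ^+ J.*2
   + c * (M.+1%:R ^+ J.*2 * d%:R ^+ J) ))).
  apply: ler_expectation => G GA; rewrite -mulrDr normrM.
  rewrite /c -!mulrA; apply: ler_pM => //.
    rewrite normrM -[2]mul1r; apply: ler_pM => //; first exact: ler_norm_monomial.
    apply: le_trans (ler_normB _ _) _; rewrite -[2]/(1 + 1).
    by apply: lerD; apply: ler_norm_entry.
  apply: le_trans (codegree_sum_bound ax GA WM) _; rewrite ler_wpM2l ?ler0n //.
  apply: le_trans (ler_power_sum _ _ _) _; rewrite ?mulr_ge0 ?ler0n //.
  rewrite -normrX ger0_norm; last by rewrite -mul2n exprM exprn_ge0 ?sqr_ge0.
  by rewrite exprMn -[in s ^+ _]mul2n exprM sd.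
rewrite expectationD expectationZ expectation_cst //.
apply: (@le_trans _ _ (c * ((\prod_(i < J) (28 * i.*2.+1)%N)%:R * d%:R ^+ J)
   + c * (M.+1%:R ^+ J.*2 * d%:R ^+ J))).
  by rewrite lerD2r ler_wpM2l // codegree_moment.
rewrite -mulrDr -mulrDl /c /codegree_constant le_eqVlt; apply/orP; left; apply/eqP.
by rewrite !mulrA.
Qed.

(** One new vertex and two new edges, of trivial size N p^2; divided by d this is a
    factor of order p. *)
Lemma defect_moment_sparse (lo hi : nat) (B : R) a b x S W : 0 <= B ->
  moment_bound N d lo hi B -> uniq [:: a; b; x] -> simple_graph S ->
  (lo <= #|S|.+3 <= hi)%N ->
  a \in W -> b \in W -> x \in W -> (forall e, e \in S -> e \subset W) ->
  [set a; b] \notin S -> [set x; b] \notin S ->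
  `|defect_moment a b x 1 S W| <= 4 * d%:R * (B * p ^+ #|S|.+2).
Proof.
move=> B0 HB U sS lh aW bW xW SW abS xbS.
have [ab xb ax] : [/\ a != b, x != b & a != x].
  by move: U; rewrite /= !inE !negb_or -!andbA (eq_sym x) => /and4P[-> -> -> _].
have pk k : 0 <= p ^+ k by rewrite exprn_ge0 // ltW.
rewrite (defect_momentS _ _ _ _ aW xW SW ax).
apply: le_trans (ler_norm_sum _ _ _) _.
apply: (@le_trans _ _ (\sum_(v : 'I_N) 2 * (B * p ^+ #|S|.+3))); last first.
  rewrite sumr_const card_ord -[leLHS]mulr_natl exprS.
  have -> (z1 z2 z3 : R) : z1 * (2 * (B * (z2 * z3))) = 2 * (z2 * z1) * (B * z3) by ring.
  apply: ler_wpM2r (mulr_ge0 B0 (pk _)) _ _ _.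
  have -> : 4 * d%:R = 2 * (2 * d%:R) :> R by ring.
  rewrite ler_wpM2l //.
  exact: ler_density_N.
rewrite big_mkcond; apply: ler_sum => v _; case: ifP => [vW|_]; last first.
  by apply: mulr_ge0 => //; apply: mulr_ge0 B0 (pk _).
set S' := attach_path a x v S.
have cS' : #|S'| = #|S|.+2 := card_attach ax aW vW SW.
have sS' : simple_graph S' := attach_simple aW xW vW sS.
have nab : [set a; b] \notin S' by apply: (attach_notin _ _ vW).
have nxb : [set x; b] \notin S' by apply: (attach_notin _ _ vW).
have -> : defect_moment a b x 0 S' (v |: W)
    = moment R d ([set a; b] |: S') - moment R d ([set x; b] |: S').
  rewrite /moment -expectationB; apply: eq_expectation => G _ /=.
  rewrite mulr1 [monomial ([set a; b] |: _) G]monomial_setU1 //.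
  by rewrite [monomial ([set x; b] |: _) G]monomial_setU1 // !entryE //; ring.
apply: le_trans (ler_normB _ _) _; rewrite mulr_natl mulr2n.
have c1 : #|[set a; b] |: S'| = #|S|.+3 by rewrite cardsU1 nab cS'.
have c2 : #|[set x; b] |: S'| = #|S|.+3 by rewrite cardsU1 nxb cS'.
apply: lerD; [rewrite -c1|rewrite -c2]; apply: HB; rewrite ?c1 ?c2 //;
  exact: simple_setU1.
Qed.

Definition step_constant (n J : nat) : R :=
  J%:R * (72 * (2 * n + 1 + J)%:R * 8 ^+ J) + 12 * n%:R.

Lemma step_constant_ge0 n J : 0 <= step_constant n J.
Proof. by rewrite addr_ge0 ?mulr_ge0 ?exprn_ge0 ?ler0n. Qed.

(** The remainder is 16^J times a constant over d^J: moments of order 2 J against the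
    2 J divisions by d. *)
Lemma moment_dense (n J : nat) (B : R) T : regular_graphs N d != set0 ->
  0 <= B -> moment_bound N d n.-2 (n + 2 * J.*2) B ->
  simple_graph T -> #|T| = n -> (0 < n)%N -> (2 * (2 * n + 1 + J.*2) <= N)%N ->
  `|moment R d T| <= step_constant n J.*2 * (B * p ^+ n / d%:R)
     + 16 ^+ J * codegree_constant (2 * n + J.*2) J / d%:R ^+ J.
Proof.
move=> ne B0 HB sT cT n0 NT.
have dp : 0 < d%:R :> R by rewrite ltr0n.
have -> : 16 ^+ J * codegree_constant (2 * n + J.*2) J / d%:R ^+ J
   = (4 / d%:R) ^+ J.*2 * (codegree_constant (2 * n + J.*2) J * d%:R ^+ J).
  rewrite -mul2n exprM (_ : (4 / d%:R) ^+ 2 = 16 / d%:R / d%:R); last by field; rewrite gt_eqF.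
  rewrite !exprMn !exprVn; field.
  by rewrite expf_neq0 // gt_eqF.
rewrite -cT; apply: (moment_step N1 d0 p2 B0 HB); rewrite ?cT // => a b x S W U sS cS cW *.
apply: defect_moment_dense => //.
  by move: U; rewrite /= !inE negb_or => /andP[/andP[]].
by rewrite -addSn leq_add2r -addn1.
Qed.

Lemma moment_sparse (n hi : nat) (B : R) T : p * d%:R <= 1 ->
  0 <= B -> moment_bound N d n.-2 hi B -> (n + 2 <= hi)%N ->
  simple_graph T -> #|T| = n -> (0 < n)%N -> (2 * (2 * n + 2) <= N)%N ->
  `|moment R d T| <= (step_constant n 1 + 16) * (B * p ^+ n / d%:R).
Proof.
move=> pd B0 HB nhi sT cT n0 NT.
have dp : 0 < d%:R :> R by rewrite ltr0n.
have pk k : 0 <= p ^+ k by rewrite exprn_ge0 // ltW.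
apply: (@le_trans _ _ (step_constant n 1 * (B * p ^+ n / d%:R)
   + (4 / d%:R) ^+ 1 * (4 * d%:R * (B * p ^+ n.+1)))).
  rewrite -cT; apply: (moment_step N1 d0 p2 B0 HB); rewrite ?cT ?muln1 -?[(2 * n + 1 + 1)%N]addnA //.
  move=> a b x S W U sS cS cW aW bW xW SW abS xbS.
  have cS1 : #|S|.+1 = n by rewrite cS prednK.
  have cS3 : #|S|.+3 = (n + 2)%N by rewrite -cS1 addn2.
  have lh : (n.-2 <= #|S|.+3 <= hi)%N.
    by rewrite cS3 nhi andbT -subn2 (leq_trans (leq_subr _ _)) ?leq_addr.
  have := defect_moment_sparse B0 HB U sS lh aW bW xW SW abS xbS.
  by rewrite -[#|S|.+2]/(#|S|.+1.+1) cS1.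
rewrite [(_ + 16) * _]mulrDl lerD2l expr1.
have -> : 4 / d%:R * (4 * d%:R * (B * p ^+ n.+1)) = 16 * (B * p ^+ n.+1).
  by field; rewrite gt_eqF.
rewrite ler_wpM2l // -mulrA ler_wpM2l // ler_pdivlMr // exprSr -mulrA.
by rewrite ler_piMr.
Qed.

End Residual.

(** * Bootstrap *)

Section Bootstrap.
Variable R : realFieldType.

Definition regime N d (s : R) : Prop :=
  [/\ (1 < N)%N, (0 < d)%N, density R N d <= 1 / 2 &
      [/\ regular_graphs N d != set0, 0 <= s & s ^+ 2 = d%:R]].

(** The trivial size p^n improved by k half powers of d, but by no more than n of them. *)
Definition moment_decay (k n : nat) (C : R) (N0 : nat) : Prop :=
  forall N d s, regime N d s -> (N0 <= N)%N ->
  forall T : graph N, simple_graph T -> #|T| = n ->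
  `|moment R d T| <= C * density R N d ^+ n / s ^+ minn k n.

Lemma moment_decayW k n C C' N0 N0' : C <= C' -> (N0 <= N0')%N ->
  moment_decay k n C N0 -> moment_decay k n C' N0'.
Proof.
move=> CC NN H N d s reg N0N T sT cT.
apply: le_trans (H N d s reg (leq_trans NN N0N) T sT cT) _.
case: reg => N1 d0 _ [_ s0 _].
rewrite -!mulrA ler_wpM2r // mulr_ge0 ?invr_ge0 ?exprn_ge0 //.
exact: ltW (density_gt0 R N1 d0).
Qed.

(** One step uses graphs with several numbers of edges at once. *)
Lemma moment_decay_uniform k hi :
  (forall n, exists C N0, moment_decay k n C N0) ->
  exists C N0, 0 <= C /\ forall n, (n <= hi)%N -> moment_decay k n C N0.
Proof.
move=> H; elim: hi => [|hi [C [N0 [C0 IH]]]].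
  have [C [N0 HC]] := H 0%N; exists `|C|, N0; split=> // n.
  by rewrite leqn0 => /eqP->; apply: moment_decayW HC => //; apply: ler_norm.
have [C' [N0' HC']] := H hi.+1; exists (C + `|C'|), (maxn N0 N0').
split=> [|n]; first by rewrite addr_ge0.
rewrite leq_eqVlt => /orP[/eqP->|].
  apply: moment_decayW HC'; rewrite ?leq_maxr //.
  by apply: le_trans (ler_norm _) _; rewrite lerDr.
by rewrite ltnS => /IH; apply: moment_decayW; rewrite ?leq_maxl // lerDl.
Qed.

Lemma moment_decay0 n : moment_decay 0 n (8 ^+ n) (16 * n)%N.
Proof.
move=> N d s [N1 d0 p2 [ne s0 sd]] NN T sT cT.
have p0 := density_gt0 R N1 d0.
have p01 : 0 <= density R N d <= 1 by rewrite ltW //=; apply: le_trans p2 _; lra.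
rewrite min0n expr0 divr1; apply: le_trans (ler_norm_expectation _ _) _.
by have := abs_moment_bound N1 d0 p01 ne sT; rewrite cT; apply.
Qed.

(** If p <= 1/d one iteration of the exchange suffices. Otherwise p^n d^(-n/2) is at
    least d^(-2n), so that J = 2 n makes the remainder harmless. Graphs
    with n - 2 edges have gained at most n - 2 half powers, and the factor 1/d adds two. *)
Lemma moment_decay_step k : (forall n, exists C N0, moment_decay k n C N0) ->
  forall n, exists C N0, moment_decay k.+2 n C N0.
Proof.
move=> H n; have [->|n0] := posnP n.
  exists 1, 0%N => N d s [N1 d0 p2 [ne s0 sd]] _ T sT cT.
  rewrite minn0 expr0 mulr1 divr1; apply: le_trans (ler_norm_expectation _ _) _.
  rewrite -[leRHS](expectation_cst 1 ne); apply: ler_expectation => G _.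
  apply: ler_norm_monomial; have p0 := density_gt0 R N1 d0.
  by rewrite ltW //=; apply: le_trans p2 _; lra.
pose J := (2 * n)%N; pose hi := (n + 2 * J.*2)%N.
pose m := minn k.+2 n.
have J1 : (2 <= 2 * J.*2)%N by rewrite /J; lia.
have J2 : (2 * n + 2 <= 2 * n + 1 + J.*2)%N by rewrite /J; lia.
have m1 : (m <= minn k n.-2 + 2)%N by rewrite /m; lia.
have m2 : (m <= 2 * n)%N by rewrite /m; lia.
have [C [N0 [C0 HC]]] := moment_decay_uniform hi H.
pose Q := step_constant R n J.*2 + (step_constant R n 1 + 16).
pose K := 16 ^+ J * codegree_constant R (2 * n + J.*2) J.
exists (Q * C + K), (N0 + 2 * (2 * n + 1 + J.*2))%N => N d s reg NN T sT cT.
case: (reg) => N1 d0 p2 [ne s0 sd].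
set p := density R N d.
have p0 : 0 < p := density_gt0 R N1 d0.
have dp : 0 < d%:R :> R by rewrite ltr0n.
have s1 : 1 <= s by apply: (root_ge1 d0 s0 sd).
have sp : 0 < s := lt_le_trans ltr01 s1.
pose B := C / s ^+ minn k n.-2.
have B0 : 0 <= B by rewrite divr_ge0 ?exprn_ge0.
have HB : moment_bound N d n.-2 hi B.
  move=> S sS /andP[loS Shi].
  have NN0 : (N0 <= N)%N := leq_trans (leq_addr _ _) NN.
  apply: le_trans (HC _ Shi N d s reg NN0 S sS erefl) _.
  rewrite /B mulrAC ler_wpM2r ?exprn_ge0 ?(ltW p0) // ler_wpM2l //.
  rewrite lef_pV2 ?posrE ?exprn_gt0 // ler_weXn2l //.
  by rewrite leq_min geq_minl (leq_trans (geq_minr _ _)).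
have gain : B * p ^+ n / d%:R <= C * p ^+ n / s ^+ m.
  rewrite /B [C / _ * _]mulrAC -[X in X <= _]mulrA -invfM -sd -exprD.
  rewrite ler_wpM2l ?mulr_ge0 ?exprn_ge0 ?(ltW p0) //.
  by rewrite lef_pV2 ?posrE ?exprn_gt0 // ler_weXn2l.
have main0 : 0 <= C * p ^+ n / s ^+ m.
  by rewrite !mulr_ge0 ?invr_ge0 ?exprn_ge0 ?(ltW p0).
have K0 : 0 <= K by rewrite mulr_ge0 ?exprn_ge0 ?codegree_constant_ge0.
have q0 := step_constant_ge0 R n.
have hNN (a : nat) : (a <= 2 * n + 1 + J.*2)%N -> (2 * a <= N)%N.
  move=> ha; apply: leq_trans NN; apply: leq_trans (leq_addl _ _).
  by rewrite leq_mul2l.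
have pm0 : 0 <= p ^+ n / s ^+ m by rewrite divr_ge0 ?exprn_ge0 ?(ltW p0).
have Bp0 : 0 <= B * p ^+ n / d%:R.
  by apply: divr_ge0; rewrite ?ler0n // mulr_ge0 // exprn_ge0 // ltW.
have Q1 : step_constant R n 1 + 16 <= Q by rewrite /Q lerDr.
have Q2 : step_constant R n J.*2 <= Q by rewrite /Q lerDl addr_ge0.
have expand (a b c z1 z2 : R) : (a * b + c) * z1 * z2 = a * (b * z1 * z2) + c * (z1 * z2).
  by ring.
rewrite expand -/m.
have [pd|pd] := leP (p * d%:R) 1.
  have nhi : (n + 2 <= hi)%N by rewrite leq_add2l.
  apply: le_trans (moment_sparse N1 d0 p2 pd B0 HB nhi sT cT n0 (hNN _ J2)) _.
  apply: (@le_trans _ _ (Q * (C * p ^+ n / s ^+ m))).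
    by apply: ler_pM => //; rewrite addr_ge0.
  by rewrite lerDl mulr_ge0.
apply: le_trans (moment_dense N1 d0 p2 s0 sd ne B0 HB sT cT n0 (hNN _ (leqnn _))) _.
apply: lerD; first exact: ler_pM.
rewrite -/K ler_wpM2l //.
(* As 1/d <= p, half of the power d^-J is at most p^n; the other half is s^-(2n). *)
have pd' : d%:R^-1 <= p by rewrite -[leLHS]mul1r ler_pdivrMr // ltW.
rewrite /J mulnC muln2 -addnn exprD invfM; apply: ler_pM.
- by rewrite invr_ge0 exprn_ge0 ?ler0n.
- by rewrite invr_ge0 exprn_ge0 ?ler0n.
- by rewrite -exprVn lerXn2r ?nnegrE ?invr_ge0 ?ler0n ?(ltW p0).
- by rewrite lef_pV2 ?posrE ?exprn_gt0 // -sd -exprM ler_weXn2l.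
Qed.

Lemma regular_moment_decay n : exists C N0, 0 <= C /\
  forall N d s, regime N d s -> (N0 <= N)%N ->
  forall T : graph N, simple_graph T -> #|T| = n ->
  `|moment R d T| <= C * (density R N d ^+ n / s ^+ n).
Proof.
have H j : forall n, exists C N0, moment_decay j.*2 n C N0.
  elim: j => [|j IHj] m; first by exists (8 ^+ m), (16 * m)%N; apply: moment_decay0.
  by rewrite doubleS; apply: moment_decay_step.
have [C [N0 HC]] := H n n; exists `|C|, N0; split=> // N d s reg NN T sT cT.
have := moment_decayW (ler_norm C) (leqnn N0) HC reg NN sT cT.
by rewrite (minn_idPr _) ?mulrA // -addnn leq_addr.
Qed.

End Bootstrap.

(** * Complements and relabelled graphs *)

Section Complement.
Variable (N : nat).
Implicit Types (G S : graph N).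

Definition pairs : graph N := [set e : {set 'I_N} | #|e| == 2%N].

Lemma complement_regular d G : (d <= N.-1)%N -> G \in regular_graphs N d ->
  toggle pairs G \in regular_graphs N (N.-1 - d).
Proof.
move=> dN GA; have sG := regular_simple GA.
have sG' : simple_graph (toggle pairs G).
  apply/forall_inP => e; rewrite mem_toggle inE.
  by have [//|ne /= /sG/eqP] := boolP (#|e| == 2%N); rewrite (negPf ne).
rewrite inE sG'; apply/forallP => v; rewrite -degree_simple //.
have := degree_neighbours v GA.
rewrite (bigD1 v) //= [X in _ -> X == _](bigD1 v) //= mem_toggle inE setUid cards1 /=.
have -> : ([set v] \in G) = false by apply/negP => /sG; rewrite cards1.
rewrite !add0n => dE; rewrite -(eqn_add2r d) subnK // -[X in (_ + X)%N == _]dE -big_split /=.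
rewrite (eq_bigr (fun=> 1%N)); first by rewrite sum1_card cardC1 card_ord.
move=> u uv; rewrite mem_toggle inE cards2 (eq_sym v) uv /=.
by case: (_ \in G).
Qed.

(** Complementation changes the sign of every centred edge. *)
Lemma moment_complement (R : realFieldType) d S : (1 < N)%N -> (d <= N.-1)%N ->
  simple_graph S -> `|moment R (N.-1 - d) S| = `|moment R d S|.
Proof.
move=> N1 dN /forall_inP sS.
have AE G : (toggle pairs G \in regular_graphs N (N.-1 - d)) = (G \in regular_graphs N d).
  apply/idP/idP => [h|]; last exact: complement_regular.
  by rewrite -(toggleK pairs G) -(subKn dN) complement_regular ?leq_subr.
have N0 : N.-1%:R != 0 :> R by rewrite pnatr_eq0; case: N N1 => [|[]].
have sum (f : graph N -> R) : \sum_(G in regular_graphs N (N.-1 - d)) f G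
    = \sum_(G in regular_graphs N d) f (toggle pairs G).
  rewrite (reindex_inj (inv_inj (@toggleK _ pairs))) /=.
  by apply: eq_bigl => G; rewrite AE.
have card : #|regular_graphs N (N.-1 - d)|%:R = #|regular_graphs N d|%:R :> R.
  by rewrite -!sumr_const sum.
have -> : moment R (N.-1 - d) S = (-1) ^+ #|S| * moment R d S.
  rewrite /moment /expectation card sum mulrA mulr_sumr; congr (_ / _).
  apply: eq_bigr => G _; rewrite /monomial -prodrN; apply: eq_bigr => e eS.
  rewrite /centred mem_toggle inE sS // /density natrB // mulrBl divff //=.
  by case: (_ \in G) => /=; ring.
by rewrite normrM normrX normrN1 expr1n mul1r.
Qed.

End Complement.

Section AllDegrees.
Variable R : rcfType.

(** For d > (N - 1) / 2 the complement has the smaller degree d' = N - 1 - d, and the size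
    (p^n d^(-n/2)) = (d^(1/2) / (N - 1))^n increases with d. *)
Lemma moment_decay_all n : exists C N0, 0 <= C :> R /\
  forall N d, (N0 <= N)%N -> (0 < d)%N -> (d < N.-1)%N ->
  forall T : graph N, simple_graph T -> #|T| = n ->
  `|moment R d T| <= C * ((d%:R / N%:R) ^+ n / Num.sqrt d%:R ^+ n).
Proof.
have [C [N0 [C0 HC]]] := regular_moment_decay R n.
exists (C * 2 ^+ n), (maxn N0 2); split; first by rewrite mulr_ge0 ?exprn_ge0.
move=> N d; rewrite geq_max => /andP[N0N N1] d0 dN T sT cT.
have [e|ne] := eqVneq (regular_graphs N d) set0.
  rewrite /moment /expectation e big_set0 mul0r normr0.
  by rewrite !mulr_ge0 ?invr_ge0 ?exprn_ge0 ?divr_ge0 ?sqrtr_ge0 ?ler0n.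
have Np : 0 < N.-1%:R :> R by rewrite ltr0n; case: (N) N1 => [|[]].
have Np' : 0 < N%:R :> R by rewrite ltr0n ltnW.
have dens_half m : (2 * m <= N.-1)%N -> density R N m <= 1 / 2.
  by move=> h; rewrite ler_pdivrMr // mulrAC mul1r ler_pdivlMr // mulrC -natrM ler_nat.
have sq m : Num.sqrt (m%:R : R) ^+ 2 = m%:R by rewrite sqr_sqrtr ?ler0n.
have sp m : (0 < m)%N -> 0 < Num.sqrt (m%:R : R) by move=> m0; rewrite sqrtr_gt0 ltr0n.
have ratio m : (0 < m)%N -> density R N m ^+ n / Num.sqrt m%:R ^+ n
    = (Num.sqrt m%:R / N.-1%:R) ^+ n.
  move=> m0; rewrite -exprVn -exprMn; congr (_ ^+ _).
  by rewrite /density -{1}sq; field; rewrite !gt_eqF ?sp.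
have sharp : `|moment R d T| <= C * (density R N d ^+ n / Num.sqrt d%:R ^+ n).
  have [h|h] := leqP (2 * d) N.-1.
    by apply: HC => //; split=> //; [apply: dens_half | split; rewrite ?sqrtr_ge0].
  rewrite -moment_complement ?(ltnW dN) //.
  have d'0 : (0 < N.-1 - d)%N by rewrite subn_gt0.
  have h' : (2 * (N.-1 - d) <= N.-1)%N by clear -h; lia.
  apply: le_trans (HC N (N.-1 - d)%N (Num.sqrt (N.-1 - d)%:R) _ N0N T sT cT) _.
    split=> //; first exact: dens_half.
    split; rewrite ?sqrtr_ge0 // -card_gt0.
    have [G GA] : exists G, G \in regular_graphs N d by apply/set0Pn.
    by apply/card_gt0P; exists (toggle (pairs N) G); rewrite complement_regular // ltnW.
  rewrite ler_wpM2l // !ratio // lerXn2r ?nnegrE ?divr_ge0 ?sqrtr_ge0 ?ler0n //.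
  rewrite ler_wpM2r ?invr_ge0 ?ler0n // ler_wsqrtr // ler_nat.
  by clear -h; lia.
apply: le_trans sharp _; rewrite -mulrA ler_wpM2l // mulrA ler_wpM2r //.
  by rewrite invr_ge0 exprn_ge0 ?sqrtr_ge0.
rewrite -exprMn lerXn2r ?nnegrE ?mulr_ge0 ?invr_ge0 ?ler0n //.
rewrite /density mulrCA ler_wpM2l ?ler0n // ler_pdivlMr // mulrC ler_pdivrMr //.
by rewrite -natrM ler_nat; clear -N1; lia.
Qed.

End AllDegrees.

Section Relabel.
Variables (R : realFieldType) (K N d : nat) (T : graph K).
Hypotheses (KN : (K <= N)%N) (T_simple : simple_graph T).

Lemma relabel_inj : injective (@relabel K N).
Proof.
move=> e f; rewrite !(relabelE KN); apply: imset_inj.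
by move=> i j /(congr1 val) /= ij; apply: val_inj.
Qed.

Lemma card_relabel e : #|@relabel K N e| = #|e|.
Proof.
rewrite (relabelE KN) card_imset // => i j /(congr1 val) /= ij; exact: val_inj.
Qed.

Definition relabel_graph : graph N := [set relabel N e | e in T].

Lemma relabel_simple : simple_graph relabel_graph.
Proof.
apply/forall_inP => _ /imsetP[e eT ->].
by rewrite card_relabel (forall_inP T_simple).
Qed.

Lemma card_relabel_graph : #|relabel_graph| = #|T|.
Proof. by rewrite card_imset //; apply: relabel_inj. Qed.

(** The probability of an edge is the density by [alphaE], unless there is no regular
    graph at all, in which case both sides vanish. *)
Lemma centered_momentE : centered_moment R T N d = moment R d relabel_graph.
Proof.
have [e|ne] := eqVneq (regular_graphs N d) set0.
  by rewrite /centered_moment /moment /expectation e !big_set0 !mul0r.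
apply: eq_expectation => G _; rewrite /monomial big_imset /=; last first.
  by move=> e f _ _; apply: relabel_inj.
apply: eq_bigr => e eT; rewrite alphaE // card_relabel.
by apply/eqP; apply: (forall_inP T_simple).
Qed.

End Relabel.

(** * Asymptotics *)

From mathcomp Require Import all_classical all_reals all_analysis.

Import Order.TTheory GRing.Theory Num.Theory.
Import numFieldNormedType.Exports.

Local Open Scope classical_set_scope.
Local Open Scope ring_scope.

Theorem theorem2p3 (R : realType) (d : nat -> nat) (eta : R)
    (d_bounds : forall N : nat, (2 <= N)%N -> (1 <= d N <= N.-1)%N)
    (d_even : forall N : nat, (2 <= N)%N -> ~~ odd (N * d N))
    (d_infty : ((d N)%:R : R) @[N --> \oo] --> +oo)
    (codeg_infty : (N%:R - (d N)%:R : R) @[N --> \oo] --> +oo)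
    (eta_gt0 : 0 < eta)
    (half_infty : `|N%:R / 2 - (d N)%:R - eta * Num.sqrt (d N)%:R| @[N --> \oo]
                    --> +oo)
    (K : nat) (T : graph K) (T_simple : simple_graph T) :
  (fun N : nat => centered_moment R T N (d N)) =O_\oo
  (fun N : nat => ((d N)%:R / N%:R) ^+ #|T| * (d N)%:R `^ (- (#|T|%:R / 2))).
Proof.
have [C [N0 [C0 HC]]] := moment_decay_all R #|T|.
apply/eqO_exP; exists (C + 1); first by rewrite ltr_wpDl.
have codeg : \forall N \near \oo, 1 < N%:R - (d N)%:R :> R.
  by move/cvgryPgt : codeg_infty; apply.
near=> N.
have N2 : (2 <= N)%N by near: N; exists 2%N.
have KN : (K <= N)%N by near: N; exists K.
have N0N : (N0 <= N)%N by near: N; exists N0.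
have d0 : (0 < d N)%N by case/andP: (d_bounds N N2).
have dN : (d N < N.-1)%N.
  have : 1 < N%:R - (d N)%:R :> R by near: N.
  by rewrite ltrBrDr nat1r ltr_nat; case: (N) N2.
have powE : (d N)%:R `^ (- (#|T|%:R / 2)) = (Num.sqrt (d N)%:R ^+ #|T|)^-1 :> R.
  by rewrite powRN mulrC powRrM powR12_sqrt ?ler0n // powR_mulrn ?sqrtr_ge0.
rewrite powE (centered_momentE _ _ KN T_simple) [X in _ <= _ * X]ger0_norm; last first.
  by rewrite mulr_ge0 ?invr_ge0 ?exprn_ge0 ?divr_ge0 ?ler0n ?sqrtr_ge0.
apply: le_trans (HC N (d N) N0N d0 dN _ _ (card_relabel_graph _ KN)) _.
  exact: relabel_simple.
by rewrite ler_wpM2r ?lerDl // mulr_ge0 ?invr_ge0 ?exprn_ge0 ?divr_ge0 ?ler0n ?sqrtr_ge0.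
Unshelve. all: by end_near.
Qed.
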